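(* Let $P$ be a nonempty set, $X$ and $Y$ Banach spaces, $F:P\times X\rightrightarrows Y$ a set-valued mapping such that $\operatorname{gph}F_p$ is closed for all $p\in P$, $\bar x\in X$, $\bar y\in Y$, $\alpha>0$, $\delta\in]0,+\infty]$ and $\mu\in]0,+\infty]$. The mapping $F$ is $\alpha$-subregular in $x$ uniformly in $p$ over $P$ at $(\bar x,\bar y)$ with $\delta$ and $\mu$ if, for some $\gamma>0$, and all $p\in P$, $x\in B_{\delta+\mu}(\bar x)$ and $y\in Y$ satisfying $x\notin F_p^{-1}(\bar y)$ and $y\in F(p,x)\cap B_{\alpha\mu}(\bar y)$, one of the following conditions is satisfied: (i) with $N:=N^C$ (Clarke normal cone), $$d_\gamma\big((0,-y^* ),N_{\operatorname{gph}F_p}(x,y)\big)\ge\alpha\qquad(\ast)$$ for all $y^*\in Y^*$ satisfying $\|y^*\|=1$ and $\langle y^*,y-\bar y\rangle=\|y-\bar y\|$; (ii) $X$ and $Y$ are Asplund, and there exists a $\tau\in]0,1[$ such that inequality $(\ast)$ holds with $N:=N^F$ (Fréchet normal cone) for all $y^*\in Y^*$ satisfying $\|y^*\|=1$ and $\langle y^*,y-\bar y\rangle>\tau\|y-\bar y\|$.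
   Context: $B_r(z)$ denotes the open ball with center $z$ and radius $r\in]0,+\infty]$. $d(z,\emptyset)=+\infty$. Products of normed spaces carry the maximum norm unless stated otherwise. For $p\in P$, $F_p:=F(p,\cdot)$, $\operatorname{gph}F_p=\{(x,y)\mid y\in F(p,x)\}$, $F_p^{-1}(y)=\{x\in X\mid y\in F(p,x)\}$. Definition. $F$ is $\alpha$-subregular in $x$ uniformly in $p$ over $P$ at $(\bar x,\bar y)$ with $\delta$ and $\mu$ if $\alpha\, d(x,F_p^{-1}(\bar y))\le d(\bar y,F(p,x))$ for all $p\in P$ and $x\in B_\delta(\bar x)$ with $d(\bar y,F(p,x))<\alpha\mu$. For $\gamma>0$, $d_\gamma$ on $X^*\times Y^*$ is the distance induced by the norm $\|(x^*,y^* )\|_\gamma=\|x^*\|+\gamma^{-1}\|y^*\|$. Fréchet normal cone to $\Omega$ at $\bar z\in\Omega$: $N^F_\Omega(\bar z)=\{z^*\mid\limsup_{\Omega\ni z\to\bar z,\,z\ne\bar z}\frac{\langle z^*,z-\bar z\rangle}{\|z-\bar z\|}\le0\}$. Clarke tangent cone $T^C_\Omega(\bar z)$: the set of $w$ such that for all sequences $z_k\to\bar z$ in $\Omega$ and $t_k\downarrow0$ there exist $w_k\to w$ with $z_k+t_kw_k\in\Omega$ for all $k$. Clarke normal cone: $N^C_\Omega(\bar z)=\{z^*\mid\langle z^*,w\rangle\le0\ \forall w\in T^C_\Omega(\bar z)\}$. A Banach space is Asplund if the dual of each of its separable subspaces is separable.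
   Formalization: The choice between (i) and (ii), and τ in (ii), may depend on p but must be the same for all (x,y); if they may vary with (x,y), as the wording literally allows, the claim fails (e.g. F constant, equal to a nonconvex union of two cones in the plane). *)

(* Defs.v *)
From HB Require Import structures.
From mathcomp Require Import all_boot all_order all_algebra.
From mathcomp Require Import all_classical all_reals.
From mathcomp Require Import ereal topology normedtype sequences.

Set Implicit Arguments.
Unset Strict Implicit.
Unset Printing Implicit Defensive.

Import Order.TTheory GRing.Theory Num.Theory.
Import numFieldNormedType.Exports.

Local Open Scope classical_set_scope.
Local Open Scope ring_scope.

(* The open ball with center z and radius r, where r may be +oo. *)
Definition eball (R : realType) (Z : normedModType R) (z : Z) (r : \bar R)
  : set Z := [set x | (`|x - z|%:E < r)%E].

(* For a linear subspace S of Z, the dual of S is represented by functions on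
   Z that are linear and continuous on S; their values outside S are
   irrelevant, so two functions that agree on S are at distance 0. *)
Definition dual_on (R : realType) (Z : normedModType R) (S : set Z)
  : set (Z -> R^o) :=
  [set f | (forall (a : R) (u v : Z), S u -> S v ->
              f (a *: u + v) = a * f u + f v) /\
           {within S, continuous f}].

Definition dual_norm_on (R : realType) (Z : normedModType R) (S : set Z)
    (f : Z -> R^o) : R :=
  sup [set `|f x| | x in [set x | S x /\ `|x| <= 1]].

Definition dual (R : realType) (Z : normedModType R) : set (Z -> R^o) :=
  [set f | linear f /\ continuous f].
Arguments dual {R} Z.

Definition dual_norm (R : realType) (Z : normedModType R) (f : Z -> R^o) : R :=
  sup [set `|f x| | x in [set x | `|x| <= 1]].

Definition separable_set (R : realType) (Z : normedModType R) (S : set Z) :=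
  exists D : set Z, [/\ countable D, D `<=` S & S `<=` closure D].

Definition separable_dual_on (R : realType) (Z : normedModType R) (S : set Z) :=
  exists D : set (Z -> R^o),
    [/\ countable D, D `<=` dual_on S &
        forall f, dual_on S f -> forall e : R, 0 < e ->
          exists2 g, D g & dual_norm_on S (f - g) < e].

(* Completeness is assumed where the predicate is used. *)
Definition asplund (R : realType) (Z : normedModType R) : Prop :=
  forall S : set Z, GRing.submod_closed [in S] ->
    separable_set S -> separable_dual_on S.
Arguments asplund {R} Z.

Section NormalCones.
Context {R : realType} {Z : normedModType R}.

(* If zbar is isolated in Omega, the limsup is -oo and the cone is the whole
   dual. *)
Definition frechet_normal_cone (Omega : set Z) (zbar : Z) : set (Z -> R^o) :=
  [set f | dual Z f /\
     (limf_esup (fun z => ((f (z - zbar) : R) / `|z - zbar|)%:E)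
        (within Omega zbar^') <= 0)%E].

Definition clarke_tangent_cone (Omega : set Z) (zbar : Z) : set Z :=
  [set w | forall (z : nat -> Z) (t : nat -> R),
     (forall k, Omega (z k)) -> z @ \oo --> zbar ->
     (forall k, 0 < t k) -> t @ \oo --> (0 : R) ->
     exists2 v : nat -> Z, v @ \oo --> w &
       forall k, Omega (z k + t k *: v k)].

Definition clarke_normal_cone (Omega : set Z) (zbar : Z) : set (Z -> R^o) :=
  [set f | dual Z f /\
     forall w, clarke_tangent_cone Omega zbar w -> (f w : R) <= 0].

End NormalCones.

Section ProductDual.
Context {R : realType} {X Y : normedModType R}.

(* The functional on X * Y that corresponds to the pair (xs, ys). *)
Definition pairing (q : (X -> R^o) * (Y -> R^o)) : X * Y -> R^o :=
  fun z => q.1 z.1 + q.2 z.2.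

Definition norm_gamma (gamma : R) (q : (X -> R^o) * (Y -> R^o)) : R :=
  dual_norm q.1 + gamma^-1 * dual_norm q.2.

(* The distance d_gamma from q to N, for N a set of functionals on X * Y. *)
Definition dist_gamma (gamma : R) (q : (X -> R^o) * (Y -> R^o))
    (N : set (X * Y -> R^o)) : \bar R :=
  ereal_inf [set (norm_gamma gamma (q - n))%:E | n in
    [set n : (X -> R^o) * (Y -> R^o) |
      [/\ dual X n.1, dual Y n.2 & N (pairing n)]]].

End ProductDual.

Section Subregularity.
Context {R : realType} {P : Type} {X Y : normedModType R}.
Implicit Types (F : P -> X -> set Y) (p : P).

Definition gph F p : set (X * Y) := [set z | F p z.1 z.2].

Definition Finv F p (y : Y) : set X := [set x | F p x y].

(* edist_inf A is the distance to A, with value +oo when A is empty. *)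
Definition uniformly_subregular F (xbar : X) (ybar : Y) (alpha : R)
    (delta mu : \bar R) : Prop :=
  forall p x, eball xbar delta x ->
    (edist_inf (F p x) ybar < alpha%:E * mu)%E ->
    (alpha%:E * edist_inf (Finv F p ybar) x <= edist_inf (F p x) ybar)%E.

(* The points (x, y) at which the normal cone conditions are imposed. *)
Definition test_point F (xbar : X) (ybar : Y) (alpha : R) (delta mu : \bar R)
    p (x : X) (y : Y) : Prop :=
  [/\ eball xbar (delta + mu)%E x, ~ Finv F p ybar x,
      F p x y & eball ybar (alpha%:E * mu)%E y].

End Subregularity.

(* Main.v *)
Require Import Defs.
From HB Require Import structures.
From mathcomp Require Import all_boot all_order all_algebra.
From mathcomp Require Import all_classical all_reals.
From mathcomp Require Import ereal topology normedtype sequences.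
From mathcomp Require Import ring lra.
Import Order.TTheory GRing.Theory Num.Theory.
Import numFieldNormedType.Exports.
Local Open Scope classical_set_scope.
Local Open Scope ring_scope.

(* Suppose that subregularity fails for p at x, let Omega be the graph of F_p
   and N(u, v) = max(|u|, gamma |v|). Ekeland's principle gives a point z of
   Omega with z.2 <> ybar that minimizes |w.2 - ybar| + a N(w - z) over Omega
   for some a < alpha. A suitable normal at z (Clarke), or near z (Frechet), is
   at d_gamma-distance less than alpha from (0, - y* ), which contradicts the
   hypothesis.
   The Clarke normal comes from the theorem of Mazur and Orlicz, the tangent
   cone being convex.
   The Frechet normal requires the fuzzy calculus of Asplund spaces, for which
   no smooth renorming is used. On a separable subspace S whose dual has a dense
   sequence g_n, the infimal convolution of a convex Lipschitz function with all
   the functions g_n + lam_n |.|^2 is Frechet differentiable along S and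
   uniformly close to the given function. Adding smoothings of small multiples
   of |. - z_i| yields a smooth variational principle, and its minimizer over
   Omega in S carries a Frechet normal relative to S. The existence of the
   wanted normal at a point is, by Mazur-Orlicz, equivalent to a family of
   inequalities on finite subsets of Omega, so S can be chosen in advance such
   that a violation in X * Y already occurs in S. *)

Set Implicit Arguments.
Unset Strict Implicit.
Unset Printing Implicit Defensive.

(** * The Mazur-Orlicz theorem *)

Section HahnBanach.
Context {R : realType} {E : lmodType R}.

Definition sublinear (p : E -> R) :=
  (forall x y, p (x + y) <= p x + p y) /\
  (forall t x, 0 < t -> p (t *: x) = t * p x).

(** An element [(x, r)] of the cone stands for the constraint [l x <= r] on a linear functional [l]
    to be found. *)
Definition convex_cone (C : set (E * R)) :=
  [/\ C (0, 0),
      (forall a b, C a -> C b -> C (a.1 + b.1, a.2 + b.2)) &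
      (forall t a, 0 < t -> C a -> C (t *: a.1, t * a.2))].

Lemma sublinear0 {p : E -> R} : sublinear p -> p 0 = 0.
Proof. by move=> [_ pZ]; have := @pZ 2 0 ltac:(lra); rewrite scaler0; lra. Qed.

Lemma sublinear_opp {p : E -> R} x : sublinear p -> - p (- x) <= p x.
Proof.
by move=> sp; have := sp.1 x (- x); rewrite subrr (sublinear0 sp); lra.
Qed.

(** The functional is the infimal convolution [q x] = inf of [p (x - a.1) + a.2] over [C].
    Subadditivity of [p] turns the positivity hypothesis into the lower bound [- p (- x)], and the
    cone axioms make [q] sublinear. *)
Lemma sublinear_below_cone (p : E -> R) (C : set (E * R)) :
  sublinear p -> convex_cone C ->
  (forall a, C a -> 0 <= p (- a.1) + a.2) ->
  exists q, [/\ sublinear q, forall x, q x <= p x & forall a, C a -> q a.1 <= a.2].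
Proof.
move=> sp [C0 CD CZ] pC; have [pD pZ] := sp.
pose A x := [set p (x - a.1) + a.2 | a in C].
have lbA x : lbound (A x) (- p (- x)).
  move=> _ [a Ca <-]; have := pC _ Ca; have := pD (x - a.1) (- x).
  by rewrite addrAC subrr add0r; lra.
have hA x : has_inf (A x).
  by split; [exists (p (x - 0) + 0), (0, 0) | exists (- p (- x))].
pose q x := inf (A x).
have qle x a : C a -> q x <= p (x - a.1) + a.2.
  by move=> Ca; apply: ge_inf; [exact: (hA x).2 | exists a].
exists q; split.
- split=> [x y|t x t0].
    apply/ler_addgt0Pr => e e0.
    have [_ [a Ca <-] la] := inf_adherent (divr_gt0 e0 (ltr0n _ 2)) (hA x).
    have [_ [b Cb <-] lb] := inf_adherent (divr_gt0 e0 (ltr0n _ 2)) (hA y).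
    have := qle (x + y) _ (CD _ _ Ca Cb) => /=.
    have := pD (x - a.1) (y - b.1).
    rewrite addrACA -opprD; move: la lb; rewrite -/(q x) -/(q y); lra.
  apply/eqP; rewrite eq_le; apply/andP; split.
    rewrite mulrC -ler_pdivrMr //; apply: lb_le_inf; first exact: (hA x).1.
    move=> _ [a Ca <-]; rewrite ler_pdivrMr //.
    have := qle (t *: x) _ (CZ _ _ t0 Ca) => /=.
    by rewrite -scalerBr pZ // mulrDl mulrC [_ * a.2]mulrC.
  apply: lb_le_inf; first exact: (hA _).1.
  move=> _ [a Ca <-]; have ti : 0 < t^-1 by rewrite invr_gt0.
  have := qle x _ (CZ _ _ ti Ca) => /=.
  have -> : x - t^-1 *: a.1 = t^-1 *: (t *: x - a.1).
    by rewrite scalerBr scalerA mulVf ?scale1r // gt_eqF.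
  by rewrite pZ // -mulrDr mulrC ler_pdivlMr // mulrC.
- by move=> x; have := qle x _ C0; rewrite subr0 addr0.
- by move=> a Ca; have := qle a.1 _ Ca; rewrite subrr (sublinear0 sp) add0r.
Qed.

(* Among the sublinear functionals below p, a minimal one is linear. *)
Lemma exists_linear_below (p : E -> R) :
  sublinear p -> exists l : E -> R,
    (forall a x y, l (a *: x + y) = a * l x + l y) /\ (forall x, l x <= p x).
Proof.
move=> sp; pose T := {q : E -> R | sublinear q /\ forall x, q x <= p x}.
(* The order is reversed, so that a maximal element in Zorn's lemma is a minimal functional. A
   nonempty chain is bounded by its pointwise infimum, the empty one by [p]. *)
pose ge (q r : T) := `[< forall x, sval r x <= sval q x >].
have [||||[q [sq qp]] qmin] := @Zorn T ge.
- by move=> q; apply/asboolP => x.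
- move=> q r s /asboolP qr /asboolP rs; apply/asboolP => x.
  exact: le_trans (rs x) (qr x).
- move=> [q hq] [r hr] /asboolP /= qr /asboolP /= rq.
  by apply/eq_exist/funext => x; apply/le_anti; rewrite qr rq.
- move=> A Atot; have [[q0 Aq0]|A0] := pselect (A !=set0); last first.
    exists (exist _ p (conj sp (fun x => lexx (p x)))) => s As.
    by exfalso; apply: A0; exists s.
  pose B x := [set sval q x | q in A].
  have lbB x : lbound (B x) (- p (- x)).
    move=> _ [[q [sq qp]] _ <-] /=; apply: le_trans (sublinear_opp x sq).
    by rewrite lerN2.
  have hB x : has_inf (B x).
    by split; [exists (sval q0 x), q0 | exists (- p (- x))].
  pose m x := inf (B x).
  have mle x q : A q -> m x <= sval q x.
    by move=> Aq; apply: ge_inf; [exact: (hB x).2 | exists q].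
  have sm : sublinear m.
    split=> [x y|t x t0].
      apply/ler_addgt0Pr => e e0.
      have [_ [a Aa <-] la] := inf_adherent (divr_gt0 e0 (ltr0n _ 2)) (hB x).
      have [_ [b Ab <-] lb] := inf_adherent (divr_gt0 e0 (ltr0n _ 2)) (hB y).
      move: la lb; rewrite -/(m x) -/(m y) => la lb.
      have := (proj1 (svalP a)).1 x y; have := (proj1 (svalP b)).1 x y.
      have := mle (x + y) _ Aa; have := mle (x + y) _ Ab.
      by case: (Atot _ _ Aa Ab) => /asboolP ab; have := ab x; have := ab y; lra.
    apply/eqP; rewrite eq_le; apply/andP; split.
      rewrite mulrC -ler_pdivrMr //; apply: lb_le_inf; first exact: (hB x).1.
      move=> _ [a Aa <-]; rewrite ler_pdivrMr //.
      by have := mle (t *: x) _ Aa; rewrite (proj1 (svalP a)).2 // mulrC.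
    apply: lb_le_inf; first exact: (hB _).1.
    move=> _ [a Aa <-]; rewrite (proj1 (svalP a)).2 // ler_pM2l //.
    exact: mle.
  have mp x : m x <= p x.
    by apply: le_trans (mle x _ Aq0) ((proj2 (svalP q0)) x).
  by exists (exist _ m (conj sm mp)) => s As; apply/asboolP => x; exact: mle.
have [qD qZ] := sq; have q0 := sublinear0 sq.
have qadd x y : q (x + y) = q x + q y.
  apply/le_anti; rewrite qD /=.
  (* The ray through [(- y, - q y)] yields a sublinear [r <= q] with [r (- y) <= - q y]. Minimality
     forces [r = q], and this value at [- y] gives the missing half of additivity. *)
  have [||r [sr rq rC]] := @sublinear_below_cone q
      [set a | exists2 t, 0 <= t & a = (t *: (- y), - (t * q y))] sq.
  - split; first by exists 0; rewrite ?scale0r ?mul0r ?oppr0.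
      move=> _ _ [s s0 ->] [t t0 ->]; exists (s + t); first exact: addr_ge0.
      by rewrite scalerDl mulrDl opprD.
    move=> s _ s0 [t t0 ->]; exists (s * t); first exact: mulr_ge0 (ltW s0) t0.
    by rewrite /= scalerA mulrN mulrA.
  - move=> _ [t t0 ->] /=; rewrite scalerN opprK.
    move: t0; rewrite le_eqVlt => /predU1P[<-|t0].
      by rewrite scale0r q0 mul0r oppr0 addr0.
    by rewrite qZ // subrr.
  have rp x' : r x' <= p x' by apply: le_trans (rq x') (qp x').
  have /(congr1 sval) /= rqE := qmin (exist _ r (conj sr rp))
    ltac:(exact/asboolP).
  have rCy : q (- y) <= - q y.
    by rewrite -{1}rqE; apply: (rC (- y, - q y)); exists 1; rewrite ?scale1r ?mul1r.
  by have := qD (x + y) (- y); rewrite -addrA subrr addr0; lra.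
have qN x : q (- x) = - q x by have := qadd x (- x); rewrite subrr q0; lra.
exists q; split=> // a x y; rewrite qadd; congr (_ + _).
have [a0|a0|->] := ltgtP a 0; last by rewrite scale0r q0 mul0r.
  by rewrite -{1}[a]opprK scaleNr qN qZ ?oppr_gt0 // mulNr opprK.
exact: qZ.
Qed.

(** Both the subgradients of convex functions and the normals at minimizers are obtained from this
    separation result. *)
Theorem mazur_orlicz (p : E -> R) (C : set (E * R)) :
  sublinear p -> convex_cone C ->
  (forall a, C a -> 0 <= p (- a.1) + a.2) ->
  exists l : E -> R, [/\ forall a x y, l (a *: x + y) = a * l x + l y,
    forall x, l x <= p x & forall a, C a -> l a.1 <= a.2].
Proof.
move=> sp cC pC; have [q [sq qp qC]] := sublinear_below_cone sp cC pC.
have [l [ll lq]] := exists_linear_below sq; exists l; split=> // [x|a Ca].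
  exact: le_trans (lq x) (qp x).
exact: le_trans (lq _) (qC _ Ca).
Qed.

End HahnBanach.

(** * Subgradients and smoothing of convex functions *)

Section Smoothing.
Context {R : realType} {E : normedModType R}.
Implicit Types (g phi : E -> R) (S : set E).

Definition linear_on S (f : E -> R) :=
  forall a u v, S u -> S v -> f (a *: u + v) = a * f u + f v.

Definition subspace S := S 0 /\ forall a u v, S u -> S v -> S (a *: u + v).

Definition convex_fun g := forall s t x y,
  0 < s -> 0 < t -> s + t = 1 -> g (s *: x + t *: y) <= s * g x + t * g y.

Definition lipschitz_fun (L : R) g := forall x y, g x - g y <= L * `|x - y|.

(* For convex g this is Frechet differentiability in the directions of S,
   expressed without derivatives. *)
Definition smooth_along S g := forall x e, 0 < e ->
  exists2 d, 0 < d & forall h, S h -> `|h| < d ->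
    g (x + h) + g (x - h) - 2 * g x <= e * `|h|.

(** [G] approximates, in the dual norm over [S], the restrictions to [S] of bounded functionals on
    the whole space; subgradients are of this kind. *)
Definition dual_approx_on S (G : nat -> E -> R) (c : nat -> R) :=
  (forall n, [/\ linear_on S (G n), 0 <= c n &
     forall v, S v -> `|G n v| <= c n * `|v|]) /\
  (forall (f : E -> R) (M e : R), linear_on setT f ->
     (forall v, `|f v| <= M * `|v|) -> 0 < e ->
     exists n, forall v, S v -> `|f v - G n v| <= e * `|v|).

Lemma subspaceN S u : subspace S -> S u -> S (- u).
Proof. by move=> [S0 SZ] Su; rewrite -scaleN1r -[X in S X]addr0; exact: SZ. Qed.

Lemma subspaceD S u v : subspace S -> S u -> S v -> S (u + v).
Proof. by move=> [S0 SZ] Su Sv; rewrite -[u]scale1r; exact: SZ. Qed.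

Lemma subspaceZ S a u : subspace S -> S u -> S (a *: u).
Proof. by move=> [S0 SZ] Su; rewrite -[X in S X]addr0; exact: SZ. Qed.

Lemma linear_on0 S f : subspace S -> linear_on S f -> f 0 = 0.
Proof.
by move=> [S0 _] fl; have := fl 1 0 0 S0 S0; rewrite scaler0 addr0; lra.
Qed.

Lemma linear_onN S f u : subspace S -> linear_on S f -> S u -> f (- u) = - f u.
Proof.
move=> sS fl Su; have := fl (-1) u 0 Su sS.1.
by rewrite scaleN1r addr0 (linear_on0 sS fl); lra.
Qed.

Lemma linear_onD S f u v :
  linear_on S f -> S u -> S v -> f (u + v) = f u + f v.
Proof. by move=> fl Su Sv; have := fl 1 u v Su Sv; rewrite scale1r mul1r. Qed.

Lemma linear_onZ S f a u :
  subspace S -> linear_on S f -> S u -> f (a *: u) = a * f u.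
Proof.
move=> sS fl Su; have := fl a u 0 Su sS.1.
by rewrite addr0 (linear_on0 sS fl) addr0.
Qed.

Lemma subspaceT : subspace setT. Proof. by split. Qed.

Lemma subgradient (L : R) g z : 0 <= L -> convex_fun g -> lipschitz_fun L g ->
  exists f : E -> R, [/\ linear_on setT f, forall h, `|f h| <= L * `|h| &
    forall h, f h <= g (z + h) - g z].
Proof.
move=> L0 gc gL.
(* This is the cone generated by the epigraph of [h |-> g (z + h) - g z]; convexity of [g] makes it
   closed under addition. *)
pose C := [set a : E * R |
  exists2 t, 0 < t & t * (g (z + t^-1 *: a.1) - g z) <= a.2].
have sp : sublinear (fun x : E => L * `|x|).
  split=> [x y|t x t0]; first by rewrite -mulrDr ler_wpM2l // ler_normD.
  by rewrite normrZ gtr0_norm // mulrCA.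
have [|a [t t0 Ca]|l [ll lp lC]] := mazur_orlicz (C := C) sp.
- split.
  + by exists 1 => //=; rewrite scaler0 addr0 subrr mulr0.
  + move=> [h c] [k d] [s s0 /= hs] [t t0 /= ht]; exists (s + t) => /=; first lra.
    have st0 : 0 < s + t by lra.
    have -> : z + (s + t)^-1 *: (h + k) = (s / (s + t)) *: (z + s^-1 *: h)
         + (t / (s + t)) *: (z + t^-1 *: k).
      rewrite !scalerDr !scalerA addrACA -scalerDl.
      have -> : s / (s + t) + t / (s + t) = 1 by field; lra.
      have -> : s / (s + t) / s = (s + t)^-1 by field; apply/andP; split; lra.
      have -> : t / (s + t) / t = (s + t)^-1 by field; apply/andP; split; lra.
      by rewrite scale1r.
    have := gc (s / (s + t)) (t / (s + t)) (z + s^-1 *: h) (z + t^-1 *: k).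
    move=> /(_ ltac:(exact: divr_gt0) ltac:(exact: divr_gt0)).
    move=> /(_ ltac:(field; lra)).
    move=> /(ler_wpM2l (ltW st0)) H; rewrite mulrBr.
    apply: le_trans (lerB H (lexx _)) _.
    have -> : (s + t) * (s / (s + t) * g (z + s^-1 *: h) +
      t / (s + t) * g (z + t^-1 *: k)) - (s + t) * g z =
      s * (g (z + s^-1 *: h) - g z) + t * (g (z + t^-1 *: k) - g z).
      by field; lra.
    exact: lerD.
  + move=> s [h c] s0 [t t0 /= ht]; exists (s * t) => /=; first exact: mulr_gt0.
    rewrite scalerA; have -> : (s * t)^-1 * s = t^-1.
      by field; apply/andP; split; lra.
    by rewrite -mulrA ler_pM2l.
- have := gL z (z + t^-1 *: a.1).
  rewrite opprD addNKr normrN normrZ gtr0_norm ?invr_gt0 //.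
  move=> /(ler_wpM2l (ltW t0)).
  rewrite mulrCA (mulrA t) divff ?gt_eqF // mul1r normrN => H.
  by apply: le_trans (lerD (lexx _) Ca); move: H; lra.
have flin : linear_on setT l by move=> a u v _ _; exact: ll.
exists l; split=> // h.
  rewrite ler_norml lp andbT; have := lp (- h).
  by rewrite (linear_onN subspaceT flin) // normrN; lra.
by apply: (lC (h, _)); exists 1 => //=; rewrite invr1 scale1r mul1r.
Qed.

Lemma sqr_norm_convex (s t : R) (x y : E) : 0 < s -> 0 < t -> s + t = 1 ->
  `|s *: x + t *: y| ^+ 2 <= s * `|x| ^+ 2 + t * `|y| ^+ 2.
Proof.
move=> s0 t0 st; have := ler_normD (s *: x) (t *: y).
rewrite !normrZ !gtr0_norm // => H.
apply: (@le_trans _ _ ((s * `|x| + t * `|y|) ^+ 2)).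
  by rewrite ler_pXn2r // nnegrE ?addr_ge0 ?mulr_ge0 // ltW.
rewrite -subr_ge0.
have -> : s * `|x| ^+ 2 + t * `|y| ^+ 2 - (s * `|x| + t * `|y|) ^+ 2 =
  s * t * (`|x| - `|y|) ^+ 2.
  have -> : t = 1 - s by lra.
  by ring.
by rewrite mulr_ge0 ?sqr_ge0 // mulr_ge0 // ltW.
Qed.

(** * Smoothing by infimal convolution with a sequence of functions *)

Section Convolution.
Context (S : set E) (G : nat -> E -> R) (c : nat -> R).
Hypothesis sS : subspace S.
Hypothesis dG : dual_approx_on S G c.
Context (phi : E -> R) (L eta : R).
Hypotheses (L0 : 0 <= L) (phic : convex_fun phi) (phiL : lipschitz_fun L phi).
Hypothesis eta0 : 0 < eta.

(* The weights make the infimum of lam n |v|^2 - (L + c n) |v| at least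
   - eta / 2 ^ n.+1. *)
Let lam n := (L + c n + 1) ^+ 2 * 2 ^+ n / eta.
Let psi n v := G n v + lam n * `|v| ^+ 2.

Let lam_gt0 n : 0 < lam n.
Proof.
have hL := L0; have [_ c0 _] := dG.1 n.
rewrite /lam divr_gt0 // mulr_gt0 ?exprn_gt0 //; lra.
Qed.

Let psi_lb n v : S v -> - (eta / 2 ^+ n.+1) <= psi n v - L * `|v|.
Proof.
have hL := L0; have he := eta0; move=> Sv.
have [_ c0 /(_ _ Sv)] := dG.1 n; rewrite ler_norml => /andP[H _].
apply: (@le_trans _ _ (lam n * `|v| ^+ 2 - (L + c n + 1) * `|v|)); last first.
  by rewrite /psi; have := normr_ge0 v; lra.
set a := L + c n + 1; set x := `|v|; have a0 : 0 < a by rewrite /a; lra.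
have p0 : 0 < (2 : R) ^+ n by exact: exprn_gt0.
rewrite exprS /lam -/a -subr_ge0.
have -> : a ^+ 2 * 2 ^+ n / eta * x ^+ 2 - a * x - - (eta / (2 * 2 ^+ n)) =
  ((2 * a * 2 ^+ n * x - eta) ^+ 2 + eta ^+ 2) / (4 * eta * 2 ^+ n).
  by field; rewrite !gt_eqF.
by rewrite divr_ge0 ?addr_ge0 ?sqr_ge0 // ?mulr_ge0 // ?ltW.
Qed.

Let psi_convex n s t x y : S x -> S y -> 0 < s -> 0 < t -> s + t = 1 ->
  psi n (s *: x + t *: y) <= s * psi n x + t * psi n y.
Proof.
move=> Sx Sy s0 t0 st; have [Gl _ _] := dG.1 n.
rewrite /psi Gl ?(linear_onZ _ sS) //; last exact: subspaceZ.
have /(ler_wpM2l (ltW (lam_gt0 n))) := sqr_norm_convex x y s0 t0 st; lra.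
Qed.

Let psi_diff n v h : S v -> S h ->
  psi n (v + h) + psi n (v - h) - 2 * psi n v <=
  lam n * (4 * `|v| * `|h| + 2 * `|h| ^+ 2).
Proof.
move=> Sv Sh; have [Gl _ _] := dG.1 n; have SNh := subspaceN sS Sh.
rewrite /psi !(linear_onD Gl) // (linear_onN sS Gl) //.
have H1 : `|v + h| ^+ 2 <= (`|v| + `|h|) ^+ 2.
  by rewrite ler_pXn2r ?nnegrE ?addr_ge0 // ler_normD.
have H2 : `|v - h| ^+ 2 <= (`|v| + `|h|) ^+ 2.
  by rewrite ler_pXn2r ?nnegrE ?addr_ge0 // ler_normB.
move: H1 H2 => /(ler_wpM2l (ltW (lam_gt0 n))) + /(ler_wpM2l (ltW (lam_gt0 n))).
have -> : (`|v| + `|h|) ^+ 2 = `|v| ^+ 2 + 2 * `|v| * `|h| + `|h| ^+ 2 by ring.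
lra.
Qed.

(* The infimal convolution at x of phi with psi 0, psi 1, ... is the infimum of
   phi (x - a.1) + a.2 over all a in the union of these sets. *)
Fixpoint conv_pts k : set (E * R) := if k is k'.+1 then
  [set a | exists2 b, conv_pts k' b & exists2 v, S v &
     a = (b.1 + v, b.2 + psi k' v)] else [set (0, 0)].

Let D := \bigcup_k conv_pts k.

Let psi0 n : psi n 0 = 0.
Proof.
have [Gl _ _] := dG.1 n.
by rewrite /psi (linear_on0 sS Gl) normr0 expr0n /= mulr0 addr0.
Qed.

Let conv_pts_mono k m a : (k <= m)%N -> conv_pts k a -> conv_pts m a.
Proof.
move=> /subnK <-; elim: (m - k)%N => // n IH /IH Da; rewrite addSn /=.
by exists a => //; exists 0; [exact: sS.1 | rewrite psi0 !addr0; case: (a)].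
Qed.

(** The losses eta / 2 ^ n.+1 of the single terms add up to a partial geometric sum, so the total
    loss stays below [eta] whatever the number of terms. *)
Let conv_lb k a : conv_pts k a -> - (eta * (1 - 2 ^- k)) <= a.2 - L * `|a.1|.
Proof.
elim: k a => [_ ->|k IH _ [b /IH Hb [v Sv ->]]] /=.
  by rewrite expr0 invr1 subrr normr0 !mulr0 subr0 oppr0.
have := psi_lb k Sv; have /(ler_wpM2l L0) := ler_normD b.1 v.
rewrite exprS; have -> : (2 * 2 ^+ k)^-1 = 2 ^- k / 2 :> R.
  by field; rewrite expf_neq0.
lra.
Qed.

(** Terms are combined one by one. Convexity of each [psi n] gives an inequality for the cost,
    whence the auxiliary value [d]. *)
Let conv_convex k a b s t : conv_pts k a -> conv_pts k b ->
  0 < s -> 0 < t -> s + t = 1 -> exists2 d, d <= s * a.2 + t * b.2 &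
    conv_pts k (s *: a.1 + t *: b.1, d).
Proof.
move=> Da Db s0 t0 st; elim: k a b Da Db => [_ _ -> ->|k IH] /=.
  by exists 0; rewrite ?mulr0 ?addr0 // !scaler0 addr0.
move=> _ _ [a Da [u Su ->]] [b Db [v Sv ->]] /=.
have [d dl Dd] := IH _ _ Da Db.
exists (d + psi k (s *: u + t *: v)).
  by have := psi_convex k Su Sv s0 t0 st; lra.
exists (s *: a.1 + t *: b.1, d) => //; exists (s *: u + t *: v).
  by apply: subspaceD => //; exact: subspaceZ.
by rewrite /= !scalerDr addrACA.
Qed.

(** In a decomposition with more than [n] terms, the n-th term [v] can be moved while all others
    stay fixed; the cost then changes only through [psi n]. *)
Let conv_shift n k a : (n < k)%N -> conv_pts k a -> exists2 v, S v &
  forall h, S h -> conv_pts k (a.1 + h, a.2 + psi n (v + h) - psi n v).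
Proof.
elim: k a => // k IH _ nk [a Da [v Sv ->]] /=.
move: nk; rewrite ltnS leq_eqVlt => /predU1P[->|nk].
  exists v => // h Sh; exists a => //; exists (v + h); first exact: subspaceD.
  by congr (_, _) => /=; [rewrite addrA | ring].
have [w Sw Hw] := IH _ nk Da; exists w => // h Sh.
exists (a.1 + h, a.2 + psi n (w + h) - psi n w); first exact: Hw.
by exists v => //=; congr (_, _); [rewrite addrAC | ring].
Qed.

Let A x := [set phi (x - a.1) + a.2 | a in D].

Let lbA x : lbound (A x) (phi x - eta).
Proof.
have he := eta0; move=> _ [a [k _ Da] <-]; have H := conv_lb Da.
have := phiL x (x - a.1); rewrite opprD addNKr opprK => HL.
have : 0 <= eta * 2 ^- k by rewrite mulr_ge0 ?ltW // invr_gt0 exprn_gt0.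
by move: H HL; lra.
Qed.

Let inD k a : conv_pts k a -> D a. Proof. by exists k. Qed.

Let D0 : D (0, 0). Proof. by exists 0%N. Qed.

Let infA x : has_inf (A x).
Proof. by split; [exists (phi (x - 0) + 0), (0, 0) | exists (phi x - eta)]. Qed.

Let Phi x := inf (A x).

Let Phi_le x a : D a -> Phi x <= phi (x - a.1) + a.2.
Proof. by move=> Da; apply: ge_inf; [exact: (infA x).2 | exists a]. Qed.

Let Phi_near x e : 0 < e -> exists2 a, D a & phi (x - a.1) + a.2 < Phi x + e.
Proof. by move=> e0; have [_ [a Da <-] H] := inf_adherent e0 (infA x); exists a. Qed.

Let Phi_convex : convex_fun Phi.
Proof.
move=> s t x y s0 t0 st; apply/ler_addgt0Pr => e e0.
have [a [k _ Da] Ha] := Phi_near x e0; have [b [m _ Db] Hb] := Phi_near y e0.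
have [d dl Dd] := conv_convex (conv_pts_mono (leq_maxl k m) Da)
  (conv_pts_mono (leq_maxr k m) Db) s0 t0 st.
have := Phi_le (s *: x + t *: y) (inD Dd).
rewrite /= opprD addrACA -!scalerBr.
have := phic (x - a.1) (y - b.1) s0 t0 st.
move: Ha Hb => /(ltW)/(ler_wpM2l (ltW s0)) Ha /(ltW)/(ler_wpM2l (ltW t0)) Hb.
have -> : e = s * e + t * e by rewrite -mulrDl st mul1r.
by move: Ha Hb; lra.
Qed.

Let Phi_lipschitz : lipschitz_fun L Phi.
Proof.
move=> x y; rewrite lerBlDl; apply/ler_addgt0Pr => e e0.
have [a Da Ha] := Phi_near y e0; have := Phi_le x Da.
have := phiL (x - a.1) (y - a.1).
by rewrite opprB addrA subrK; move: Ha; lra.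
Qed.

(* At x, choose n such that G n is close to a subgradient f of Phi at x. For
   every nearly optimal decomposition of x, the point v of its n-th term
   satisfies lam n |v| <= |f - G n| approximately, and moving only this term
   bounds the second difference of Phi by that of psi n. *)
Let Phi_smooth : smooth_along S Phi.
Proof.
move=> x e e0; have [f [fl fL fs]] := subgradient x L0 Phi_convex Phi_lipschitz.
(* The final estimate consumes 8 r |h| for 4 lam |v| |h|, 2 r |h| for 2 lam |h|^2, and 2 r |h| for
   the error [q] occurring twice. *)
pose r := e / 12; have r0 : 0 < r by rewrite /r; lra.
have [n Hn] := dG.2 f L r fl fL r0; have lam0 := lam_gt0 n.
exists (r / lam n) => [|h Sh hd]; first exact: divr_gt0.
have [->|h0] := eqVneq h 0.
  by rewrite normr0 mulr0 addr0 subr0; lra.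
have nh0 : 0 < `|h| by rewrite normr_gt0.
pose q := Num.min (2 * r ^+ 2 / lam n) (r * `|h|).
have q0 : 0 < q.
  by rewrite lt_min !mulr_gt0 ?divr_gt0 ?mulr_gt0 ?exprn_gt0 // invr_gt0.
have [a [k _ Da] Ha] := Phi_near x q0.
have [v Sv Hv] := conv_shift (leq_maxl n.+1 k) (conv_pts_mono (leq_maxr n.+1 k) Da).
have step u : S u -> Phi (x + u) <= Phi x + q + psi n (v + u) - psi n v.
  move=> Su; have := Phi_le (x + u) (inD (Hv u Su)).
  by rewrite /= opprD addrACA subrr addr0; move: Ha; lra.
have [Gl _ _] := dG.1 n; have SNv := subspaceN sS Sv.
(* Deleting the term [v] gives a decomposition of [x - v]. Together with the subgradient inequality
   at [- v] this yields lam |v|^2 <= q + r |v|, and the first entry of [q] excludes lam |v| > 2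
   r. *)
have lamv : lam n * `|v| <= 2 * r.
  have fT := linear_onN subspaceT fl (I : setT v).
  have := step _ SNv; rewrite subrr psi0; have := fs (- v); rewrite fT.
  have := Hn _ Sv; rewrite ler_norml => /andP[_]; rewrite /psi.
  move=> H1 H2 H3; have H : lam n * `|v| ^+ 2 <= q + r * `|v| by move: H1 H2 H3; lra.
  rewrite leNgt; apply/negP => H4.
  have v0 : 0 <= `|v| by [].
  have H5 : 2 * r * `|v| <= lam n * `|v| * `|v| by rewrite ler_wpM2r // ltW.
  have H6 : q <= 2 * r ^+ 2 / lam n by rewrite ge_min lexx.
  move: H6; rewrite ler_pdivlMr // => H6.
  have H7 : r * `|v| <= q by move: H H5; rewrite expr2; lra.
  move: H7 => /(ler_wpM2l (ltW lam0)) H7; move: H4.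
  rewrite -(ltr_pM2l r0) => H8; move: H6 H7 H8; rewrite expr2; lra.
have := step h Sh; have := step _ (subspaceN sS Sh).
have := psi_diff n Sv Sh.
have lamh : lam n * `|h| <= r by rewrite mulrC -ler_pdivlMr // ltW.
have qh : q <= r * `|h| by rewrite ge_min lexx orbT.
move: lamv lamh => /(ler_wpM2r (ltW nh0)) lamv /(ler_wpM2r (ltW nh0)) lamh.
have -> : e = 12 * r by rewrite /r; field.
by move: lamv lamh qh; rewrite expr2; lra.
Qed.

Theorem convex_smoothing : exists g : E -> R, [/\ convex_fun g,
  lipschitz_fun L g, smooth_along S g & forall x, phi x - eta <= g x <= phi x].
Proof.
exists Phi; split=> // x; apply/andP; split.
  by apply: lb_le_inf; [exact: (infA x).1 | exact: lbA].
by have := Phi_le x D0; rewrite subr0 addr0.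
Qed.

End Convolution.
End Smoothing.

(** * Variational principles *)

Section Completeness.
Context {R : realType}.

(** Completeness in a form with an explicit rate, which passes to products coordinate by
    coordinate. *)
Definition geom_complete (Z : normedModType R) :=
  forall (u : nat -> Z) (c : R), (forall n, `|u n.+1 - u n| <= c / 2 ^+ n) ->
  exists2 l, u @ \oo --> l & forall n, `|u n - l| <= 2 * c / 2 ^+ n.

Lemma cvg_geom0 (c : R) : (fun n => c / 2 ^+ n) @ \oo --> (0 : R).
Proof.
have -> : (fun n => c / 2 ^+ n) = geometric c 2^-1.
  by apply/funext => n; rewrite /geometric /= exprVn.
by apply: cvg_geometric; rewrite ger0_norm; lra.
Qed.

Lemma geom_lt (c e : R) : 0 < e -> exists n, c / 2 ^+ n < e.
Proof.
move=> e0; have /cvgrPdist_lt/(_ e e0) [n _ /(_ n (leqnn n))] := cvg_geom0 c.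
by rewrite sub0r normrN => /(le_lt_trans (ler_norm _)) => H; exists n.
Qed.

Lemma geom_dist (Z : normedModType R) (u : nat -> Z) (c : R) :
  (forall n, `|u n.+1 - u n| <= c / 2 ^+ n) ->
  forall n m, (n <= m)%N -> `|u n - u m| <= 2 * c / 2 ^+ n.
Proof.
move=> uc n m /subnK <-; set k := (m - n)%N.
have c0 : 0 <= c by have := le_trans (normr_ge0 _) (uc 0%N); rewrite expr0 divr1.
have p0 j : 0 < (2 : R) ^+ j by exact: exprn_gt0.
suff H : `|u n - u (k + n)%N| <= 2 * c / 2 ^+ n - 2 * c / 2 ^+ (k + n).
  by apply: le_trans H _; rewrite gerBl divr_ge0 ?mulr_ge0 // ltW.
elim: k => [|k IH]; first by rewrite add0n !subrr normr0.
apply: le_trans (ler_distD (u (k + n)%N) _ _) _.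
have := uc (k + n)%N; rewrite -(distrC (u (k + n)%N) (u (k + n).+1)) addSn exprS => H.
have -> : 2 * c / (2 * 2 ^+ (k + n)) = c / 2 ^+ (k + n).
  by field; rewrite gt_eqF.
by move: IH H; lra.
Qed.

Lemma geom_completeP (Z : completeNormedModType R) : geom_complete Z.
Proof.
move=> u c uc; have dist := geom_dist uc.
have uC : cvg (u @ \oo).
  apply/cauchy_cvgP/cauchy_exP => e e0.
  have [n Hn] := geom_lt (2 * c) e0; exists (u n), n => // m nm.
  by rewrite /= -ball_normE /=; exact: le_lt_trans (dist _ _ nm) Hn.
exists (lim (u @ \oo)) => // n.
have H : (fun m => `|u n - u m|) @ \oo --> (`|u n - lim (u @ \oo)| : R).
  by apply: cvg_norm; apply: cvgB => //; exact: cvg_cst.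
by apply: (closed_cvg (fun x => x <= _)) H; [exact: closed_le | exists n => // m; exact: dist].
Qed.

Lemma geom_complete_prod (X Y : normedModType R) :
  geom_complete X -> geom_complete Y -> geom_complete (X * Y)%type.
Proof.
move=> cX cY u c uc.
have [|l1 ul1 d1] := cX (fst \o u) c.
  by move=> n; apply: le_trans (uc n); rewrite prod_normE le_max lexx.
have [|l2 ul2 d2] := cY (snd \o u) c.
  by move=> n; apply: le_trans (uc n); rewrite prod_normE le_max lexx orbT.
exists (l1, l2) => [|n]; last by rewrite prod_normE ge_max d1 d2.
have -> : u = (fun n => ((u n).1, (u n).2)).
  by apply/funext => n; case: (u n).
exact: cvg_pair ul1 ul2.
Qed.

Lemma lipschitz_cvg (Z : normedModType R) (L : R) (f : Z -> R) (u : nat -> Z) l :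
  lipschitz_fun L f -> u @ \oo --> l -> (fun n => f (u n)) @ \oo --> f l.
Proof.
move=> fL ul; apply/cvgrPdist_le => e e0.
have L1 : 0 < `|L| + 1 by have := normr_ge0 L; lra.
have /cvgrPdist_lt/(_ _ (divr_gt0 e0 L1)) := ul.
apply: filterS => n; rewrite ltr_pdivlMr // => H.
have Hle x : L * `|x| <= `|x| * (`|L| + 1) :> R.
  by rewrite mulrC ler_wpM2l // (le_trans (ler_norm L)) // lerDl.
have := fL l (u n); have := fL (u n) l; rewrite (distrC (u n) l).
by have := Hle Z (l - u n); rewrite ler_norml; move: H; lra.
Qed.

End Completeness.

(** The index is carried along in the state, so that the invariant and the relation may depend on
    it. *)
Lemma dependent_choice_along (T : Type) (P : nat -> T -> Prop)
    (Q : nat -> T -> T -> Prop) (s0 : T) :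
  P 0%N s0 -> (forall i s, P i s -> exists2 s', P i.+1 s' & Q i s s') ->
  exists2 u : nat -> T, u 0%N = s0 & forall i, P i (u i) /\ Q i (u i) (u i.+1).
Proof.
move=> P0 step.
have [|u [u0 uS]] := @dependent_choice {x : nat * T | P x.1 x.2}
  (fun x y => (sval y).1 = (sval x).1.+1 /\
     Q (sval x).1 (sval x).2 (sval y).2) _ (exist _ (0%N, s0) P0).
  move=> [[i s] /= Ps]; have /cid2[s' Ps' Qs] := step i s Ps.
  by exists (exist _ (i.+1, s') Ps').
have u1 i : (sval (u i)).1 = i.
  by elim: i => [|i IH]; [rewrite u0 | rewrite (uS i).1 IH].
exists (fun i => (sval (u i)).2) => [|i]; first by rewrite u0.
by have := svalP (u i); have := (uS i).2; rewrite !u1.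
Qed.

(** * Ekeland's variational principle *)

Section Ekeland.
Context {R : realType} {Z : normedModType R}.

(* N plays the role of an equivalent norm on Z. *)
Theorem ekeland (N f : Z -> R) (k K L a : R) (A : set Z) (z0 : Z) :
  geom_complete Z -> closed A -> A z0 ->
  sublinear N -> 0 < k -> (forall x, k * `|x| <= N x) -> lipschitz_fun K N ->
  lipschitz_fun L f -> (forall w, A w -> 0 <= f w) -> 0 < a ->
  exists z, [/\ A z, f z + a * N (z - z0) <= f z0 &
    forall w, A w -> f z <= f w + a * N (w - z)].
Proof.
move=> cZ clA Az0 sN k0 kN NK fL f0 a0.
have N0 x : 0 <= N x by apply: le_trans (kN x); rewrite mulr_ge0 // ltW.
(* [S z] collects the points below [z] in Ekeland's order. Each [u n.+1] minimizes [f] over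
   [S (u n)] up to 2^-n. *)
pose S z := [set w | A w /\ f w + a * N (w - z) <= f z].
have Strans z w v : S z w -> S w v -> S z v.
  move=> [Aw zw] [Av wv]; split=> //.
  have := sN.1 (v - w) (w - z); rewrite addrA subrK -(ler_pM2l a0) => H.
  by move: zw wv H; lra.
have Srefl z : A z -> S z z by move=> Az; split; rewrite // subrr (sublinear0 sN); lra.
have [|u u0 Hu] := @dependent_choice_along Z (fun _ => A)
    (fun i z z' => S z z' /\ forall v, S z v -> f z' <= f v + 2 ^- i) z0 Az0.
  move=> i z Az; have hi : has_inf (f @` S z).
    split; first by exists (f z), z => //; exact: Srefl.
    by exists 0 => _ [w [Aw _] <-]; exact: f0.
  have i0 : 0 < (2 : R) ^- i by rewrite invr_gt0 exprn_gt0.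
  have [_ [w Sw <-] Hw] := inf_adherent i0 hi; exists w; first exact: Sw.1.
  split=> // v Sv; apply: (le_trans (ltW Hw)); rewrite lerD2r.
  by apply: ge_inf; [exact: hi.2 | exists v].
have uS m n : (m <= n)%N -> S (u m) (u n).
  move=> /subnK <-; elim: (n - m)%N => [|j IH].
    by apply: Srefl; exact: (Hu m).1.
  by apply: Strans IH _; rewrite addSn; exact: (Hu _).2.1.
have fcl n v : S (u n) v -> f (u n.+1) <= f v + 2 ^- n by apply: (Hu n).2.2.
(* The shift discards the step from [u 0] to [u 1], whose length is not controlled by
   near-minimality. From [u n.+1] to [u n.+2] the function [f] decreases by at most 2^-n. *)
have [|l ul _] := cZ (fun n => u n.+1) (a * k)^-1.
  move=> n; have [_ H1] := uS n.+1 n.+2 (leqnSn _).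
  have H2 := fcl n _ (uS n n.+2 (leqW (leqnSn n))).
  have := kN (u n.+2 - u n.+1); rewrite -(ler_pM2l a0) => H3.
  by rewrite mulrC ler_pdivlMr ?mulr_gt0 // mulrC -mulrA; move: H1 H2 H3; lra.
have Al : A l.
  by apply: (closed_cvg A clA _ _ ul); exists 0%N => // n _; exact: (Hu _).1.
have Sl n : S (u n) l.
  split=> //.
  have H : (fun m => f (u m.+1) + a * N (u m.+1 - u n)) @ \oo --> f l + a * N (l - u n).
    apply: cvgD; first exact: lipschitz_cvg fL ul.
    apply: cvgM; first exact: cvg_cst.
    by apply: (lipschitz_cvg NK); apply: cvgB => //; exact: cvg_cst.
  apply: (closed_cvg (fun x => x <= f (u n)) _ _ _ H); first exact: closed_le.
  by exists n => // m nm; exact: (uS n m.+1 (leqW nm)).2.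
exists l; split=> //; first by rewrite -u0; exact: (Sl 0%N).2.
move=> w Aw; rewrite leNgt; apply/negP => H.
have Slw : S l w by split=> //; exact: ltW.
(* A point [w] violating the conclusion lies in every [S (u n)], hence its value cannot be below the
   limit of the near-minimal values. *)
have : f l <= f w.
  apply/ler_addgt0Pr => e e0; have [n] := geom_lt 1 e0; rewrite mul1r => Hn.
  have := fcl n _ (Strans _ _ _ (Sl n) Slw); have [_] := Sl n.+1.
  have := mulr_ge0 (ltW a0) (N0 (l - u n.+1)); move: Hn; lra.
by have := mulr_ge0 (ltW a0) (N0 (w - l)); move: H; lra.
Qed.

End Ekeland.

(** * A variational principle with perturbations smooth along a subspace *)

Section SmoothVariational.
Context {R : realType} {Z : normedModType R}.
Implicit Types (f g : Z -> R).

Lemma convex_funD f g : convex_fun f -> convex_fun g -> convex_fun (f \+ g).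
Proof.
move=> fc gc s t x y s0 t0 st /=.
by have := fc s t x y s0 t0 st; have := gc s t x y s0 t0 st; lra.
Qed.

Lemma lipschitz_funD (K L : R) f g :
  lipschitz_fun K f -> lipschitz_fun L g -> lipschitz_fun (K + L) (f \+ g).
Proof. by move=> fK gL x y /=; have := fK x y; have := gL x y; lra. Qed.

Lemma smooth_alongD S f g :
  smooth_along S f -> smooth_along S g -> smooth_along S (f \+ g).
Proof.
move=> fS gS x e e0; have e2 : 0 < e / 2 by lra.
have [d d0 Hf] := fS x _ e2; have [d' d'0 Hg] := gS x _ e2.
exists (Num.min d d') => [|h Sh]; first by rewrite lt_min d0.
by rewrite lt_min /= => /andP[/(Hf _ Sh) + /(Hg _ Sh)]; lra.
Qed.

Lemma convex_fun_norm (a : R) (z : Z) :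
  0 <= a -> convex_fun (fun w => a * `|w - z|).
Proof.
move=> a0 s t x y s0 t0 st.
have -> : s *: x + t *: y - z = s *: (x - z) + t *: (y - z).
  by rewrite !scalerBr addrACA -opprD -scalerDl st scale1r.
have := ler_normD (s *: (x - z)) (t *: (y - z)).
by rewrite !normrZ !gtr0_norm // => /(ler_wpM2l a0); lra.
Qed.

Lemma lipschitz_fun_norm (a : R) (z : Z) :
  0 <= a -> lipschitz_fun a (fun w => a * `|w - z|).
Proof.
move=> a0 x y; rewrite -mulrBr ler_wpM2l //.
by have := ler_dist_dist (x - z) (y - z); rewrite opprB addrA subrK ler_norml => /andP[].
Qed.

(* The perturbation is a series of smoothings of eps 2^-(i+1) |. - z_i|, the
   points z_i being approximate minimizers of the preceding partial sums. *)
Theorem smooth_variational_principle (S A : set Z) (G : nat -> Z -> R)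
    (c : nat -> R) (phi : Z -> R) (L eps r : R) (z0 : Z) :
  geom_complete Z -> subspace S -> dual_approx_on S G c -> closed A ->
  0 < eps -> 0 < r -> lipschitz_fun L phi -> (exists B, forall w, A w -> B <= phi w) ->
  A z0 -> (forall w, A w -> phi z0 <= phi w + eps * r / 64) ->
  exists psi z, [/\ convex_fun psi, lipschitz_fun eps psi, smooth_along S psi &
    [/\ A z, `|z - z0| <= r & forall w, A w -> phi z + psi z <= phi w + psi w]].
Proof.
move=> cZ sS dG clA eps0 r0 phiL [B0 phi0] Az0 Hz0.
(* The slopes [e i] sum to [eps]. The tolerances [eta i] decay faster, so that the bound 3 eta_i /
   e_i on the i-th step is geometric and at most r / 8 / 2^i. *)
pose e i : R := eps / 2 ^+ i.+1; pose eta i : R := eps * r / 64 / 4 ^+ i.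
have p0 i : 0 < (2 : R) ^+ i by exact: exprn_gt0.
have q0 i : 0 < (4 : R) ^+ i by exact: exprn_gt0.
have e0 i : 0 < e i by exact: divr_gt0.
have eta0 i : 0 < eta i by rewrite !divr_gt0 // mulr_gt0.
pose P i (s : (Z -> R) * Z) := [/\ convex_fun s.1,
  lipschitz_fun (eps * (1 - 2 ^- i)) s.1, smooth_along S s.1,
  exists B, forall w, B <= s.1 w &
  A s.2 /\ forall w, A w -> phi s.2 + s.1 s.2 <= phi w + s.1 w + eta i].
pose Q i (s s' : (Z -> R) * Z) := exists2 rho : Z -> R, s'.1 = s.1 \+ rho &
  lipschitz_fun (e i) rho /\
  forall w, e i * `|w - s.2| - eta i <= rho w <= e i * `|w - s.2|.
have [||u u0 Hu] := @dependent_choice_along _ P Q ((fun=> 0), z0).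
- split=> //=.
  + by move=> s t x y *; rewrite !mulr0 addr0.
  + by move=> x y; rewrite expr0 invr1 !subrr mulr0 mul0r.
  + move=> x d d0; exists 1 => // h _ _.
    by rewrite !addr0 mulr0 subr0 mulr_ge0 // ltW.
  + by exists 0.
  + split=> // w Aw; rewrite !addr0 /eta expr0 divr1; exact: Hz0.
- move=> i [psi z] [/= psic psiL psiS [B psiB] [Az Hz]].
  have [rho [rhoc rhoL rhoS Hrho]] := convex_smoothing sS dG (ltW (e0 i))
    (convex_fun_norm z (ltW (e0 i))) (lipschitz_fun_norm z (ltW (e0 i))) (eta0 i).
  pose h w := phi w + (psi w + rho w).
  have rho_lb w : - eta i <= rho w.
    have /andP[+ _] := Hrho w; apply: le_trans.
    by rewrite lerDr mulr_ge0 // ltW.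
  have hi : has_inf (h @` A).
    split; first by exists (h z), z.
    exists (B0 + B - eta i) => _ [w Aw <-]; rewrite /h.
    by have := phi0 _ Aw; have := psiB w; have := rho_lb w; lra.
  have [_ [z' Az' <-] Hz'] := inf_adherent (eta0 i.+1) hi.
  exists (psi \+ rho, z'); last by exists rho.
  split=> /=.
  + exact: convex_funD.
  + have -> : eps * (1 - 2 ^- i.+1) = eps * (1 - 2 ^- i) + e i.
      by rewrite /e exprS; field; rewrite gt_eqF.
    exact: lipschitz_funD.
  + exact: smooth_alongD.
  + by exists (B - eta i) => w; have := psiB w; have := rho_lb w; lra.
  + split=> // w Aw; rewrite -/(h z') -/(h w); apply: (le_trans (ltW Hz')).
    by rewrite lerD2r; apply: ge_inf; [exact: hi.2 | exists w].
pose psi i := (u i).1; pose z i := (u i).2.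
have psic i : convex_fun (psi i) by case: (Hu i) => -[].
have psiL i : lipschitz_fun (eps * (1 - 2 ^- i)) (psi i) by case: (Hu i) => -[].
have psiS i : smooth_along S (psi i) by case: (Hu i) => -[].
have Az i : A (z i) by case: (Hu i) => -[_ _ _ _ []].
have Hz i w : A w -> phi (z i) + psi i (z i) <= phi w + psi i w + eta i.
  by case: (Hu i) => -[_ _ _ _ [_ +]] _; apply.
have Hrho i : exists2 rho : Z -> R, psi i.+1 = psi i \+ rho &
  lipschitz_fun (e i) rho /\
  forall w, e i * `|w - z i| - eta i <= rho w <= e i * `|w - z i|.
  by case: (Hu i).
(* [z i] nearly minimizes the old sum and [z i.+1] the new one, so the added term, which grows like
   e_i |w - z_i|, is at most about [eta i] at [z i.+1]. *)
have z_step i : `|z i.+1 - z i| <= r / 8 / 2 ^+ i.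
  have [rho E [_ rhoE]] := Hrho i.
  have H1 := Hz i _ (Az i.+1); have := Hz i.+1 _ (Az i); rewrite E /=.
  have /andP[H2 _] := rhoE (z i.+1); have /andP[_] := rhoE (z i).
  rewrite subrr normr0 mulr0 => H3 H4.
  have H5 : e i * `|z i.+1 - z i| <= 3 * eta i.
    have H6 : eta i.+1 <= eta i.
      by rewrite ler_pM2l ?divr_gt0 ?mulr_gt0 // lef_pV2 ?posrE // ler_eXn2l //; lra.
    by move: H1 H2 H3 H4; lra.
  move: H5; rewrite mulrC -ler_pdivlMr //; move=> H5; apply: le_trans H5 _.
  have -> : 3 * eta i / e i = (3 * r / 32) / 2 ^+ i.
    by rewrite /eta /e exprS -[4]/(2 * 2)%:R natrM exprMn; field; rewrite !gt_eqF.
  by rewrite ler_pM2r ?invr_gt0 //; lra.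
have z_dist := geom_dist z_step.
have [l zl ldist] := cZ _ _ z_step.
have psi_step w : exists C, forall i, `|psi i.+1 w - psi i w| <= C / 2 ^+ i.
  exists (eps * (`|w - z 0%N| + r)) => i.
  have [rho -> [_ /(_ w)/andP[rho1 rho2]]] := Hrho i.
  rewrite /= addrAC subrr add0r.
  have H1 : `|w - z i| <= `|w - z 0%N| + r / 4.
    apply: le_trans (ler_distD (z 0%N) _ _) _; rewrite lerD2l.
    by apply: le_trans (z_dist _ _ (leq0n i)) _; rewrite expr0; lra.
  have H2 : eta i <= e i * (r / 2).
    rewrite /eta /e exprS -[4]/(2 * 2)%:R natrM exprMn.
    rewrite -subr_ge0.
    have -> : eps / (2 * 2 ^+ i) * (r / 2) - eps * r / 64 / (2 ^+ i * 2 ^+ i) =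
      eps * r / 64 / (2 ^+ i * 2 ^+ i) * (16 * 2 ^+ i - 1).
      by field; rewrite gt_eqF.
    have : 1 <= (2 : R) ^+ i by rewrite exprn_ege1 //; lra.
    by move=> ?; rewrite mulr_ge0 ?divr_ge0 ?mulr_ge0 ?ltW //; lra.
  have -> : eps * (`|w - z 0%N| + r) / 2 ^+ i = e i * (2 * (`|w - z 0%N| + r)).
    by rewrite /e exprS; field; rewrite gt_eqF.
  have H3 : e i * `|w - z i| <= e i * (`|w - z 0%N| + r / 4).
    by rewrite ler_wpM2l // ltW.
  have H4 : 0 <= e i * `|w - z i| by rewrite mulr_ge0 // ltW.
  have H5 : 0 <= e i * `|w - z 0%N| by rewrite mulr_ge0 // ltW.
  have H6 : 0 <= e i * r by rewrite mulr_ge0 // ltW.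
  by rewrite ler_norml; move: H2 H3; lra.
have psi_lim w : exists y : R, (fun i => psi i w) @ \oo --> y.
  have [C HC] := psi_step w.
  by have [y Hy _] := geom_completeP (Z := R^o) HC; exists y.
have [psi' psi'E] := choice psi_lim.
(* The remainder of the series has a small Lipschitz constant; this lets smoothness pass to the
   limit. *)
have tail n m : (n <= m)%N ->
  lipschitz_fun (eps * (2 ^- n - 2 ^- m)) (fun w => psi m w - psi n w).
  move=> /subnK <-; elim: (m - n)%N => [|k IH] x y.
    by rewrite add0n !subrr mulr0 mul0r.
  have [rho E [rhoL _]] := Hrho (k + n)%N; rewrite addSn E /=.
  have := IH x y; have := rhoL x y; rewrite /e exprS.
  have -> : eps / (2 * 2 ^+ (k + n)) = eps * (2 ^- (k + n) - (2 * 2 ^+ (k + n))^-1).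
    by field; rewrite gt_eqF.
  by lra.
have tail' n : lipschitz_fun (eps * 2 ^- n) (fun w => psi' w - psi n w).
  move=> x y.
  have H : (fun m => psi m x - psi n x - (psi m y - psi n y)) @ \oo -->
      psi' x - psi n x - (psi' y - psi n y).
    by apply: cvgB; apply: cvgB => //; exact: cvg_cst.
  apply: (closed_cvg (fun t => t <= eps * 2 ^- n * `|x - y|) _ _ _ H).
    exact: closed_le.
  exists n => // m nm /=; apply: le_trans (tail n m nm x y) _.
  by rewrite ler_wpM2r // (ler_wpM2l (ltW eps0)) // gerBl invr_ge0 ltW.
exists psi', l; split.
- move=> s t x y s0 t0 st.
  have H1 := psi'E (s *: x + t *: y).
  have H2 : (fun i => s * psi i x + t * psi i y) @ \oo --> s * psi' x + t * psi' y.
    by apply: cvgD; apply: cvgM => //; exact: cvg_cst.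
  by apply: ler_cvg_to H1 H2 _; exists 0%N => // i _; exact: psic.
- move=> x y; have := tail' 0%N x y; have := psiL 0%N x y.
  by rewrite expr0 invr1 subrr mulr0 mul0r mulr1; lra.
(* The partial sum [psi n] uses half of [d]; the tail, with Lipschitz constant below d / 4, enters
   the second difference twice and uses the other half. *)
- move=> x d d0; have [n Hn] := geom_lt eps (divr_gt0 d0 (ltr0n _ 4)).
  have [d' d'0 Hd'] := psiS n x _ (divr_gt0 d0 (ltr0n _ 2)).
  exists d' => // h Sh hd; have := Hd' h Sh hd.
  have := tail' n (x + h) x; have := tail' n (x - h) x.
  have -> : x + h - x = h by rewrite addrAC subrr add0r.
  have -> : x - h - x = - h by rewrite addrAC subrr add0r.
  rewrite normrN => H1 H2 H3.
  have H4 : eps / 2 ^+ n * `|h| <= d / 4 * `|h| by rewrite ler_wpM2r // ltW.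
  by move: H1 H2 H3 H4; lra.
- split=> [||w Aw].
  + by apply: (closed_cvg A clA _ _ zl); exists 0%N.
  + have := ldist 0%N; have -> : z 0%N = z0 by rewrite /z u0.
    by rewrite distrC expr0 => /le_trans; apply; lra.
  have eta_cvg : eta @ \oo --> (0 : R).
    have -> : eta = geometric (eps * r / 64) 4^-1.
      by apply/funext => n; rewrite /geometric /= exprVn.
    by apply: cvg_geometric; rewrite ger0_norm; lra.
  have psiz : (fun i => psi i (z i)) @ \oo --> psi' l.
    have -> : (fun i => psi i (z i)) = (fun i => (psi i (z i) - psi i l) + psi i l).
      by apply/funext => i; rewrite subrK.
    rewrite -[X in _ --> X]add0r; apply: cvgD => //.
    apply/cvgrPdist_le => d d0.
    have /cvgrPdist_lt/(_ _ (divr_gt0 d0 eps0)) := zl.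
    apply: filterS => i; rewrite ltr_pdivlMr // sub0r normrN => H.
    have epsi t : 0 <= t -> eps * (1 - 2 ^- i) * t <= t * eps.
      move=> t0; have : 0 <= eps * 2 ^- i * t.
        by rewrite !mulr_ge0 ?invr_ge0 // ltW.
      by lra.
    have := psiL i (z i) l; have := psiL i l (z i); rewrite (distrC (z i) l).
    by have := epsi _ (normr_ge0 (l - z i)); rewrite ler_norml; move: H; lra.
  have H1 : (fun i => phi (z i) + psi i (z i)) @ \oo --> phi l + psi' l.
    by apply: cvgD => //; exact: lipschitz_cvg phiL zl.
  have H2 : (fun i => phi w + psi i w + eta i) @ \oo --> phi w + psi' w + 0.
    by apply: cvgD => //; apply: cvgD => //; exact: cvg_cst.
  rewrite -[leRHS]addr0; apply: ler_cvg_to H1 H2 _.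
  by exists 0%N => // i _; exact: Hz.
Qed.

End SmoothVariational.

(** * Functionals on weighted products *)

Section DualElements.
Context {R : realType} {Z : normedModType R}.
Implicit Types f : Z -> R^o.

Lemma dual_of_bounded f (M : R) :
  linear_on setT f -> (forall v, `|f v| <= M * `|v|) -> dual Z f.
Proof.
move=> fl fM; split; first by move=> a u v; exact: fl.
move=> x; apply/cvgrPdist_le => e e0.
have M1 : 0 < `|M| + 1 by have := normr_ge0 M; lra.
apply/nbhs_ballP; exists (e / (`|M| + 1)); first exact: divr_gt0.
move=> y; rewrite -ball_normE /= ltr_pdivlMr // => xy.
have -> : f x - f y = f (x - y).
  by rewrite (linear_onD fl) // (linear_onN (@subspaceT _ Z) fl).
apply: le_trans (fM _) _; apply: le_trans _ (ltW xy).
by rewrite mulrC ler_wpM2l // (le_trans (ler_norm M)) // lerDl.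
Qed.

Lemma dual_norm_le f (M : R) :
  0 <= M -> (forall v, f v <= M * `|v|) -> linear_on setT f -> dual_norm f <= M.
Proof.
move=> M0 fM fl; apply: ge_sup.
  by exists `|f 0|, 0 => //=; rewrite normr0.
move=> _ [v /= v1 <-]; rewrite ler_norml.
have H : M * `|v| <= M by rewrite ler_piMr.
have := fM v; have := fM (- v).
by rewrite (linear_onN (@subspaceT _ Z) fl) // normrN; move: H; lra.
Qed.

Lemma dual_norm_ge f (M : R) v :
  (forall v, `|f v| <= M * `|v|) -> `|v| <= 1 -> `|f v| <= dual_norm f.
Proof.
move=> fM v1; apply: ub_le_sup; last by exists v.
exists `|M| => _ [w /= w1 <-]; apply: le_trans (fM w) _.
by apply: le_trans (ler_wpM2r _ (ler_norm M)) _; rewrite // ler_piMr.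
Qed.

Lemma le_dual_norm f (M : R) v :
  linear_on setT f -> (forall v, `|f v| <= M * `|v|) ->
  `|f v| <= dual_norm f * `|v|.
Proof.
move=> fl fM; have [->|v0] := eqVneq v 0.
  by rewrite (linear_on0 (@subspaceT _ Z) fl) !normr0 mulr0.
have nv0 : 0 < `|v| by rewrite normr_gt0.
rewrite -ler_pdivrMr //.
have <- : `|f (`|v|^-1 *: v)| = `|f v| / `|v|.
  rewrite (linear_onZ _ (@subspaceT _ Z) fl) // normrM ger0_norm ?invr_ge0 //.
  exact: mulrC.
by apply: (dual_norm_ge fM); rewrite normrZ ger0_norm ?invr_ge0 // mulVf ?gt_eqF.
Qed.

End DualElements.

(** * The weighted maximum norm and the distance dual to it *)

Section WeightedProduct.
Context {R : realType} {X Y : normedModType R}.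

Definition max_norm (gamma : R) (z : X * Y) : R :=
  Num.max `|z.1| (gamma * `|z.2|).

Variable gamma : R.
Hypothesis gamma0 : 0 < gamma.

Lemma max_norm_sublinear : sublinear (max_norm gamma).
Proof.
split=> [x y|t x t0]; rewrite /max_norm /=.
  rewrite ge_max; apply/andP; split.
    apply: le_trans (ler_normD _ _) _.
    by apply: lerD; rewrite le_max lexx.
  apply: (@le_trans _ _ (gamma * `|x.2| + gamma * `|y.2|)).
    by rewrite -mulrDr ler_wpM2l ?ler_normD // ltW.
  by apply: lerD; rewrite le_max lexx orbT.
by rewrite !normrZ gtr0_norm // mulrCA maxr_pMr // ltW.
Qed.

Lemma max_norm_ge0 z : 0 <= max_norm gamma z.
Proof. by rewrite /max_norm le_max normr_ge0. Qed.

Lemma max_normN z : max_norm gamma (- z) = max_norm gamma z.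
Proof. by rewrite /max_norm /= !normrN. Qed.

Lemma max_norm_lb z : Num.min 1 gamma * `|z| <= max_norm gamma z.
Proof.
rewrite /max_norm prod_normE.
have m0 : 0 <= Num.min 1 gamma by rewrite le_min ler01 ltW.
rewrite maxr_pMr // ge_max !le_max; apply/andP; split; apply/orP.
  by left; rewrite ler_piMl // ge_min lexx.
by right; rewrite ler_wpM2r // ge_min lexx orbT.
Qed.

Lemma max_norm_ub z : max_norm gamma z <= Num.max 1 gamma * `|z|.
Proof.
rewrite /max_norm ge_max prod_normE; apply/andP; split.
  apply: (@le_trans _ _ (1 * `|z.1|)); first by rewrite mul1r.
  by apply: ler_pM => //; rewrite le_max lexx.
by apply: ler_pM => //; rewrite ?le_max ?lexx ?orbT // ltW.
Qed.

Lemma max_norm_lipschitz : lipschitz_fun (Num.max 1 gamma) (max_norm gamma).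
Proof.
move=> x y; apply: le_trans (max_norm_ub _).
by have := max_norm_sublinear.1 (x - y) y; rewrite subrK; lra.
Qed.

(** The theorem of Mazur and Orlicz on X * Y * Y, the last factor carrying [ys]. The pair (xs, b -
    ys) is the future normal: subtracting it from (0, - ys) leaves (- xs, - b), which the weighted
    norm controls by [a]. *)
Lemma exists_dual_triple (K : set (X * Y * R)) (v0 : Y) (th a : R) :
  0 <= a -> convex_cone K ->
  (forall h t, K h -> 0 <= t ->
     t * th <= a * max_norm gamma h.1 + `|h.1.2 + t *: v0| + h.2) ->
  exists (xs : X -> R^o) (b ys : Y -> R^o),
    [/\ [/\ linear_on setT xs, linear_on setT b & linear_on setT ys],
        forall u v, xs u + b v <= a * max_norm gamma (u, v),
        forall v, `|ys v| <= `|v|, th <= ys v0 &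
        forall h, K h -> xs h.1.1 + (b h.1.2 - ys h.1.2) <= h.2].
Proof.
move=> a0 [K0 KD KZ] Kpos; have [ND NZ] := max_norm_sublinear.
pose p (e : X * Y * Y) := a * max_norm gamma e.1 + `|e.2|.
have sp : sublinear p.
  split=> [x y|t x t0]; rewrite /p /=.
    have := ler_normD x.2 y.2; have := ler_wpM2l a0 (ND x.1 y.1); lra.
  by rewrite NZ // normrZ gtr0_norm //; ring.
(* The part of an element coming from [h] encodes the constraint of [K] on (xs, b - ys), the part
   coming from [t] encodes [th <= ys v0]. *)
pose C := [set e : X * Y * Y * R | exists (h : X * Y * R) (t : R),
  [/\ K h, 0 <= t & e = ((h.1, - h.1.2 - t *: v0), h.2 - t * th)]].
have [||l [ll lp lC]] := mazur_orlicz (C := C) sp.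
- split.
  + exists (0, 0), 0; split=> //=; by rewrite scale0r mul0r !subr0 oppr0.
  + move=> _ _ [h [s [Kh s0 ->]]] [k [t [Kk t0 ->]]].
    exists (h.1 + k.1, h.2 + k.2), (s + t); split; [exact: KD|exact: addr_ge0|].
    congr ((_, _), _) => /=; last by rewrite mulrDl; ring.
    by rewrite scalerDl !opprD addrACA.
  + move=> s _ s0 [h [t [Kh t0 ->]]].
    exists (s *: h.1, s * h.2), (s * t); split; [exact: KZ|exact: mulr_ge0 (ltW s0) t0|].
    congr ((_, _), _) => /=; last by ring.
    by rewrite scalerBr scalerN scalerA.
- move=> _ [h [t [Kh t0 ->]]]; rewrite /p /= max_normN opprB opprK addrC.
  by rewrite (addrC (t *: v0)); have := Kpos h t Kh t0; lra.
have lT : linear_on setT l by move=> c u v _ _; exact: ll.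
pose xs u : R^o := l ((u, 0), 0); pose b v : R^o := l ((0, v), 0).
pose ys v : R^o := l (0, v).
exists xs, b, ys.
have xsl : linear_on setT xs.
  move=> c u v _ _; rewrite /xs -ll; congr l.
  by congr ((_, _), _); rewrite /= scaler0 addr0.
have bl : linear_on setT b.
  move=> c u v _ _; rewrite /b -ll; congr l.
  by congr ((_, _), _); rewrite /= scaler0 addr0.
have ysl : linear_on setT ys.
  move=> c u v _ _; rewrite /ys -ll; congr l.
  by congr (_, _); rewrite /= scaler0 addr0.
have lE u v w : l ((u, v), w) = xs u + b v + ys w.
  rewrite /xs /b /ys -!(linear_onD lT) //; congr l.
  by congr ((_, _), _); rewrite /= ?add0r ?addr0.
have ysv v : ys v <= `|v|.
  apply: le_trans (lp _) _; rewrite /p /= /max_norm /= !normr0 mulr0 maxxx mulr0.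
  by rewrite add0r.
split=> //.
- move=> u v; have := lp ((u, v), 0); rewrite lE /p /= normr0 addr0.
  by rewrite (linear_on0 (@subspaceT _ Y) ysl) addr0.
- move=> v; rewrite ler_norml ysv andbT; have := ysv (- v).
  by rewrite (linear_onN (@subspaceT _ Y) ysl) // normrN; lra.
- have := lC ((0, - v0), - th); rewrite /= lE.
  rewrite (linear_on0 (@subspaceT _ X) xsl) (linear_on0 (@subspaceT _ Y) bl).
  rewrite (linear_onN (@subspaceT _ Y) ysl) // => H.
  suff : 0 + 0 - ys v0 <= - th by lra.
  apply: H; exists (0, 0), 1; split=> //.
  by congr ((_, _), _); rewrite /= ?scale1r ?mul1r ?oppr0 ?sub0r.
- move=> [[u v] c] /= Kh; have := lC ((u, v, - v), c); rewrite /= lE.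
  rewrite (linear_onN (@subspaceT _ Y) ysl) // -addrA => -> //.
  exists ((u, v), c), 0; split=> //.
  by congr ((_, _), _); rewrite /= ?scale0r ?mul0r subr0.
Qed.

(** The dual of a weighted maximum norm is a sum norm with the inverse weight: the signs of the two
    arguments can be chosen independently. *)
Lemma dual_norm_sum_le (xs : X -> R^o) (b : Y -> R^o) (a : R) :
  linear_on setT xs -> linear_on setT b ->
  (forall u v, xs u + b v <= a * max_norm gamma (u, v)) -> 0 <= a ->
  dual_norm xs + gamma^-1 * dual_norm b <= a.
Proof.
move=> xl bl H a0; have gi : 0 < gamma^-1 by rewrite invr_gt0.
have xN := linear_onN (@subspaceT _ X) xl; have bN := linear_onN (@subspaceT _ Y) bl.
have abs u v : `|u| <= 1 -> `|v| <= 1 -> `|xs u| + gamma^-1 * `|b v| <= a.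
  move=> u1 v1.
  have H1 u' v' : `|u'| <= 1 -> `|v'| <= 1 -> xs u' + gamma^-1 * b v' <= a.
    move=> u'1 v'1; rewrite -(linear_onZ _ (@subspaceT _ Y) bl) //.
    apply: le_trans (H _ _) _; rewrite ler_piMr // /max_norm ge_max /= u'1 /=.
    by rewrite normrZ gtr0_norm // mulrA divff ?gt_eqF // mul1r.
  have Nu : `|- u| <= 1 by rewrite normrN.
  have Nv : `|- v| <= 1 by rewrite normrN.
  have := H1 _ _ u1 v1; have := H1 _ _ Nu v1; have := H1 _ _ u1 Nv.
  have := H1 _ _ Nu Nv; rewrite xN // bN //.
  by case: (ger0P (xs u)) => ?; case: (ger0P (b v)) => ?; lra.
have z1 (V : normedModType R) : `|0 : V| <= 1 by rewrite normr0.
have le1 v : `|v| <= 1 -> dual_norm xs <= a - gamma^-1 * `|b v|.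
  move=> v1; apply: ge_sup; first by exists `|xs 0|, 0 => //=; exact: z1.
  by move=> _ [u /= u1 <-]; have := abs u v u1 v1; lra.
suff : dual_norm b <= gamma * (a - dual_norm xs).
  move=> /(ler_wpM2l (ltW gi)); rewrite mulrA mulVf ?gt_eqF // mul1r; lra.
apply: ge_sup; first by exists `|b 0|, 0 => //=; exact: z1.
move=> _ [v /= v1 <-]; have H1 := le1 v v1.
have -> : `|b v| = gamma * (gamma^-1 * `|b v|).
  by rewrite mulrA divff ?gt_eqF // mul1r.
by rewrite ler_pM2l //; lra.
Qed.

(* Dividing the functionals by |ys| turns ys into a unit vector. *)
Lemma dist_gamma_normalized (N : set (X * Y -> R^o)) (xs : X -> R^o)
    (b ys : Y -> R^o) (a th : R) (v0 : Y) :
  0 <= a -> 0 < th -> v0 != 0 ->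
  linear_on setT xs -> linear_on setT b -> linear_on setT ys ->
  (forall u v, xs u + b v <= a * max_norm gamma (u, v)) ->
  (forall v, `|ys v| <= `|v|) -> th * `|v0| <= ys v0 ->
  (forall (s : R) (n := ((fun u => s * xs u) : X -> R^o,
      (fun v => s * (b v - ys v)) : Y -> R^o)),
     0 < s -> dual (X * Y)%type (pairing n) -> N (pairing n)) ->
  exists us : Y -> R^o, [/\ dual Y us, dual_norm us = 1,
    forall v, us v <= `|v|, th * `|v0| <= us v0 &
    (dist_gamma gamma (0, - us)%R N <= (a / th)%:E)%E].
Proof.
move=> a0 th0 v00 xl bl yl xb y1 yv NN.
have nv0 : 0 < `|v0| by rewrite normr_gt0.
have yM v : `|ys v| <= 1 * `|v| by rewrite mul1r.
pose n := dual_norm ys.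
have nth : th <= n.
  rewrite -(ler_pM2r nv0); apply: le_trans yv _; apply: le_trans (ler_norm _) _.
  exact: le_dual_norm yl yM.
have n0 : 0 < n by apply: lt_le_trans nth.
have n1 : n <= 1.
  apply: dual_norm_le => // v; rewrite mul1r; exact: le_trans (ler_norm _) (y1 v).
have ni : 0 < n^-1 by rewrite invr_gt0.
have scale_lin (V : normedModType R) (f : V -> R) : linear_on setT f ->
    linear_on setT (fun v => n^-1 * f v).
  by move=> fl c u v _ _; rewrite fl //; ring.
pose us v : R^o := n^-1 * ys v.
have x00 := linear_on0 (@subspaceT _ X) xl; have b00 := linear_on0 (@subspaceT _ Y) bl.
have xM v : `|xs v| <= a * `|v|.
  have nX (v' : X) : max_norm gamma (v', 0) = `|v'|.
    by rewrite /max_norm /= normr0 mulr0; apply/max_idPl.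
  have := xb v 0; have := xb (- v) 0; rewrite b00 !nX normrN.
  by rewrite (linear_onN (@subspaceT _ X) xl) // ler_norml; lra.
have bM v : `|b v| <= a * gamma * `|v|.
  have nY (v' : Y) : max_norm gamma (0, v') = gamma * `|v'|.
    by rewrite /max_norm /= normr0; apply/max_idPr; rewrite mulr_ge0 // ltW.
  have := xb 0 v; have := xb 0 (- v); rewrite x00 !nY normrN.
  by rewrite (linear_onN (@subspaceT _ Y) bl) // ler_norml; lra.
have scale_dual (V : normedModType R) (f : V -> R) (M : R) : linear_on setT f ->
    (forall v, `|f v| <= M * `|v|) -> dual V (fun v => n^-1 * f v : R^o).
  move=> fl fM; apply: (@dual_of_bounded _ _ _ (n^-1 * M)); first exact: scale_lin.
  by move=> v; rewrite normrM gtr0_norm // -mulrA ler_pM2l.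
have bysl : linear_on setT (fun v => b v - ys v).
  by move=> c u v _ _; rewrite bl // yl //; ring.
exists us; split.
- exact: scale_dual yl yM.
- apply/le_anti/andP; split.
    apply: dual_norm_le => //; last exact: scale_lin.
    move=> v; rewrite mul1r /us mulrC ler_pdivrMr // mulrC.
    by apply: le_trans (le_dual_norm v yl yM); exact: ler_norm.
  rewrite -(ler_pM2l n0) mulr1 /n; apply: dual_norm_le => //.
  + rewrite mulr_ge0 // ?(ltW n0) //.
    apply: le_trans (@dual_norm_ge _ _ us n^-1 0 _ _); rewrite ?normr0 //.
    move=> v; rewrite /us normrM gtr0_norm // ler_pM2l //; exact: y1.
  + move=> v; have H : `|us v| <= dual_norm us * `|v|.
      apply: (@le_dual_norm _ _ us n^-1); first exact: scale_lin.
      by move=> w; rewrite /us normrM gtr0_norm // ler_pM2l.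
    have -> : ys v = n * us v by rewrite /us mulrA divff ?gt_eqF // mul1r.
    by rewrite -mulrA ler_pM2l // (le_trans (ler_norm _)).
- move=> v; rewrite /us mulrC ler_pdivrMr // mulrC.
  by apply: le_trans (le_dual_norm v yl yM); exact: ler_norm.
- have yv0 : 0 <= ys v0 by apply: (le_trans _ yv); rewrite mulr_ge0 // ltW.
  by rewrite /us; apply: (le_trans yv); rewrite ler_peMl // invf_ge1.
- have bysM v : `|b v - ys v| <= (a * gamma + 1) * `|v|.
    by have := ler_normB (b v) (ys v); have := bM v; have := y1 v; lra.
  have sb : N (pairing ((fun u => n^-1 * xs u) : X -> R^o,
      (fun v => n^-1 * (b v - ys v)) : Y -> R^o)).
    apply: NN => //.
    apply: (@dual_of_bounded _ _ _ (n^-1 * a + n^-1 * (a * gamma + 1))).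
      by move=> c u v _ _; rewrite /pairing /= xl // bl // yl //; ring.
    move=> w; rewrite /pairing /=; apply: le_trans (ler_normD _ _) _.
    rewrite !normrM (gtr0_norm ni) mulrDl -!mulrA.
    apply: lerD; rewrite ler_pM2l //.
      apply: le_trans (xM _) _; apply: ler_wpM2l => //.
      by rewrite prod_normE le_max lexx.
    apply: le_trans (bysM _) _; apply: ler_wpM2l.
      by rewrite addr_ge0 // mulr_ge0 // ltW.
    by rewrite prod_normE le_max lexx orbT.
  apply: (@le_trans _ _ (norm_gamma gamma ((0, - us) - ((fun u => n^-1 * xs u) : X -> R^o,
      (fun v => n^-1 * (b v - ys v)) : Y -> R^o)))%:E).
    apply: ereal_inf_lbound; exists ((fun u => n^-1 * xs u) : X -> R^o,
      (fun v => n^-1 * (b v - ys v)) : Y -> R^o) => //=; split=> //=.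
      exact: scale_dual xl xM.
    exact: (scale_dual _ _ (a * gamma + 1) bysl).
  rewrite lee_fin; apply: (@le_trans _ _ (a / n)); last first.
    by rewrite ler_wpM2l // lef_pV2.
  rewrite /norm_gamma /=.
  (* The contributions of [ys] cancel, and the difference is (- xs, - b) divided by [n], of norm at
     most a / n. *)
  have -> : 0 - (fun u => n^-1 * xs u : R^o) = (fun u => - (n^-1 * xs u)).
    by rewrite sub0r; apply/funext.
  have -> : - us - (fun v => n^-1 * (b v - ys v) : R^o) = (fun v => - (n^-1 * b v)).
    by apply/funext => v; rewrite !fctE /us; ring.
  apply: dual_norm_sum_le.
  + by move=> c u v _ _; rewrite xl //; ring.
  + by move=> c u v _ _; rewrite bl //; ring.
  + move=> u v.
    have -> : - (n^-1 * xs u) - n^-1 * b v = n^-1 * (xs (- u) + b (- v)).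
      by rewrite (linear_onN (@subspaceT _ X) xl) // (linear_onN (@subspaceT _ Y) bl) //; ring.
    have := xb (- u) (- v); rewrite (_ : (- u, - v) = - (u, v)) // max_normN => H.
    by rewrite -mulrA mulrCA ler_pM2l.
  + by rewrite divr_ge0 // ltW.
Qed.

End WeightedProduct.

(** * Clarke normals at a constrained minimizer *)

Section Clarke.
Context {R : realType}.

Lemma clarke_tangent_cone0 (Z : normedModType R) (A : set Z) z :
  clarke_tangent_cone A z 0.
Proof.
move=> u t Au _ _ _; exists (fun=> 0); first exact: cvg_cst.
by move=> k; rewrite scaler0 addr0.
Qed.

(** The base points in the definition may vary: after the step along [v] the points still lie in [A]
    and tend to [z], so the step along [w] can start there. *)
Lemma clarke_tangent_coneD (Z : normedModType R) (A : set Z) z v w :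
  clarke_tangent_cone A z v -> clarke_tangent_cone A z w ->
  clarke_tangent_cone A z (v + w).
Proof.
move=> Tv Tw u t Au uz t0 tc; have [v' v'c Av'] := Tv u t Au uz t0 tc.
have uv : (fun k => u k + t k *: v' k) @ \oo --> z.
  rewrite -[z]addr0 -(scale0r v); apply: cvgD => //; exact: cvgZ.
have [w' w'c Aw'] := Tw _ t Av' uv t0 tc.
exists (fun k => v' k + w' k); first exact: cvgD.
by move=> k; rewrite scalerDr addrA.
Qed.

Lemma clarke_tangent_coneZ (Z : normedModType R) (A : set Z) z (s : R) v :
  0 < s -> clarke_tangent_cone A z v -> clarke_tangent_cone A z (s *: v).
Proof.
move=> s0 Tv u t Au uz t0 tc.
have [||v' v'c Av'] := Tv u (fun k => t k * s) Au uz.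
- by move=> k; exact: mulr_gt0.
- by rewrite -(mul0r s); apply: cvgM => //; exact: cvg_cst.
exists (fun k => s *: v' k); last by move=> k; rewrite scalerA.
by apply: cvgZ => //; exact: cvg_cst.
Qed.

Context {X Y : normedModType R}.

(** Minimality is tested at z + s_k v_k, with v_k tending to [w]. Writing the new residual as (1 -
    s_k t) v0 + s_k (v_k.2 + t v0), where v0 = z.2 - ybar, lets |v0| cancel before division by
    s_k. *)
Lemma clarke_first_order (A : set (X * Y)) (z w : X * Y) (ybar : Y) (gamma a t : R) :
  0 < gamma -> 0 <= a -> A z -> clarke_tangent_cone A z w -> 0 < t ->
  (forall w, A w ->
     `|z.2 - ybar| <= `|w.2 - ybar| + a * max_norm gamma (w - z)) ->
  t * `|z.2 - ybar| <= a * max_norm gamma w + `|w.2 + t *: (z.2 - ybar)|.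
Proof.
move=> g0 a0 Az Tw t0 zmin; have [ND NZ] := @max_norm_sublinear _ X Y gamma g0.
(* The factor [t^-1] ensures s_k t <= 1, so that 1 - s_k t is a nonnegative coefficient. *)
pose s k : R := t^-1 / 2 ^+ k.
have p0 k : 0 < (2 : R) ^+ k by exact: exprn_gt0.
have s0 k : 0 < s k by rewrite /s divr_gt0 // invr_gt0.
have st k : s k * t <= 1.
  rewrite /s mulrAC mulVf ?gt_eqF // div1r invf_le1 // exprn_ege1 //; lra.
have [v vw Av] := Tw (fun=> z) s (fun=> Az) (@cvg_cst _ _ _ _ _) s0 (cvg_geom0 _).
have Hk k : t * `|z.2 - ybar| <=
    a * max_norm gamma (v k) + `|(v k).2 + t *: (z.2 - ybar)|.
  have Ez : z + s k *: v k - z = s k *: v k by rewrite addrAC subrr add0r.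
  have := zmin _ (Av k); rewrite Ez NZ //.
  have -> : (z + s k *: v k).2 - ybar = (1 - s k * t) *: (z.2 - ybar) +
      s k *: ((v k).2 + t *: (z.2 - ybar)).
    rewrite /= [X in _ = _ + X]scalerDr scalerA scalerBl scale1r.
    by rewrite [X in _ = _ + X]addrC addrA subrK addrAC.
  move=> H; rewrite -(ler_pM2l (s0 k)).
  have := ler_normD ((1 - s k * t) *: (z.2 - ybar))
      (s k *: ((v k).2 + t *: (z.2 - ybar))).
  rewrite 2!normrZ (gtr0_norm (s0 k)) ger0_norm ?subr_ge0 //.
  by move: H; lra.
have H : (fun k => a * max_norm gamma (v k) + `|(v k).2 + t *: (z.2 - ybar)|)
    @ \oo --> a * max_norm gamma w + `|w.2 + t *: (z.2 - ybar)|.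
  apply: cvgD; first apply: cvgM; first exact: cvg_cst.
    exact: lipschitz_cvg (max_norm_lipschitz g0) vw.
  apply: (@lipschitz_cvg _ _ 1 (fun w : X * Y => `|w.2 + t *: (z.2 - ybar)|)) vw.
  move=> x y; rewrite mul1r; apply: (@le_trans _ _ `|(x - y).2|).
    have := ler_normD (x.2 - y.2) (y.2 + t *: (z.2 - ybar)).
    by rewrite addrA subrK lerBlDr.
  by rewrite prod_normE le_max lexx orbT.
by apply: (closed_cvg (fun r => t * `|z.2 - ybar| <= r) _ _ _ H);
  [exact: closed_ge | exists 0%N].
Qed.

(** The constraint cone is the tangent cone with bound 0. The threshold |z.2 - ybar| forces [ys] to
    attain its norm there, so normalization does not enlarge [a]. *)
Theorem clarke_normal_of_minimizer (A : set (X * Y)) (z : X * Y) (ybar : Y)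
    (gamma a : R) :
  0 < gamma -> 0 <= a -> A z -> z.2 != ybar ->
  (forall w, A w ->
     `|z.2 - ybar| <= `|w.2 - ybar| + a * max_norm gamma (w - z)) ->
  exists ys : Y -> R^o, [/\ dual Y ys, dual_norm ys = 1,
    ys (z.2 - ybar) = `|z.2 - ybar| &
    (dist_gamma gamma (0, - ys)%R (clarke_normal_cone A z) <= a%:E)%E].
Proof.
move=> g0 a0 Az zy zmin; set v0 := z.2 - ybar.
have v00 : v0 != 0 by rewrite subr_eq0.
pose K := [set h : X * Y * R | clarke_tangent_cone A z h.1 /\ h.2 = 0].
have [|h t [Th ->]|xs [b [ys [[xl bl yl] xb y1 yv KC]]]] :=
    exists_dual_triple (v0 := v0) (th := `|v0|) g0 a0 (K := K).
- split; first by split=> //; exact: clarke_tangent_cone0.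
    move=> h k [Th h0] [Tk k0]; split; last by rewrite /= h0 k0 addr0.
    exact: clarke_tangent_coneD.
  move=> t h t0 [Th h0]; split; last by rewrite /= h0 mulr0.
  exact: clarke_tangent_coneZ.
- rewrite le_eqVlt addr0 => /predU1P[<-|t0].
    by rewrite mul0r addr_ge0 // mulr_ge0 // max_norm_ge0.
  exact: (clarke_first_order g0 a0 Az Th t0 zmin).
have yv1 : 1 * `|v0| <= ys v0 by rewrite mul1r.
have [|us [du u1 uv uv0 dle]] := dist_gamma_normalized
    (N := clarke_normal_cone A z) g0 a0 ltr01 v00 xl bl yl xb y1 yv1.
  move=> s n s0 dn; split=> // w Tw.
  rewrite /n /pairing /= -mulrDr pmulr_rle0 //.
  by apply: (KC (w, 0)).
exists us; split=> //; last by rewrite divr1 in dle.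
by apply/le_anti; rewrite uv -[leLHS]mul1r uv0.
Qed.

End Clarke.

(** * Separable reduction *)

Section SeparableDual.
Context {R : realType}.

Lemma dual_on_bounded (Z : normedModType R) (S : set Z) (f : Z -> R^o) :
  subspace S -> dual_on S f ->
  exists2 C : R, 0 <= C & forall v, S v -> `|f v| <= C * `|v|.
Proof.
move=> sS [fl fc]; have f0 : f 0 = 0 := linear_on0 sS fl.
move: fc => /subspace_continuousP/(_ 0 sS.1).
move=> /cvgrPdist_lt/(_ 1 ltr01); move=> /nbhs_ballP[e /= e0 He].
exists (2 / e) => [|v Sv]; first by rewrite divr_ge0 // ltW.
have [->|v0] := eqVneq v 0; first by rewrite f0 !normr0 mulr0.
have nv0 : 0 < `|v| by rewrite normr_gt0.
pose t : R := e / 2 / `|v|; have t0 : 0 < t by rewrite !divr_gt0.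
have := He (t *: v); rewrite -ball_normE /= sub0r normrN normrZ gtr0_norm //.
rewrite /t mulfVK ?gt_eqF // => /(_ ltac:(lra) (subspaceZ _ sS Sv)).
rewrite /from_subspace -/t f0 sub0r normrN (linear_onZ _ sS fl) // normrM gtr0_norm // => H.
rewrite -(ler_pM2l t0); apply: (le_trans (ltW H)).
by have -> : t * (2 / e * `|v|) = 1 by rewrite /t; field; rewrite !gt_eqF.
Qed.

Lemma le_dual_norm_on (Z : normedModType R) (S : set Z) (f : Z -> R^o) (C : R) v :
  subspace S -> linear_on S f -> (forall v, S v -> `|f v| <= C * `|v|) ->
  S v -> `|f v| <= dual_norm_on S f * `|v|.
Proof.
move=> sS fl fC Sv; have [->|v0] := eqVneq v 0.
  by rewrite (linear_on0 sS fl) !normr0 mulr0.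
have nv0 : 0 < `|v| by rewrite normr_gt0.
rewrite -ler_pdivrMr //.
have <- : `|f (`|v|^-1 *: v)| = `|f v| / `|v|.
  by rewrite (linear_onZ _ sS fl) // normrM ger0_norm ?invr_ge0 // mulrC.
apply: ub_le_sup.
  exists `|C| => _ [w /= [Sw w1] <-]; apply: le_trans (fC w Sw) _.
  by apply: le_trans (ler_wpM2r _ (ler_norm C)) _; rewrite // ler_piMr.
exists (`|v|^-1 *: v) => //; split; first exact: subspaceZ.
by rewrite normrZ ger0_norm ?invr_ge0 // mulVf ?gt_eqF.
Qed.

Lemma separable_dual_sequence (Z : normedModType R) (S : set Z) :
  subspace S -> separable_dual_on S ->
  exists g : nat -> Z -> R^o, (forall n, dual_on S (g n)) /\
    forall f, dual_on S f -> forall e : R, 0 < e ->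
      exists n, forall v, S v -> `|f v - g n v| <= e * `|v|.
Proof.
move=> sS [D [/countable_injP[i iinj] DS Ddense]].
have z0 : dual_on S (fun=> 0 : R^o).
  split=> [a u v _ _|]; first by rewrite mulr0 addr0.
  by apply/subspace_continuousP => x _; exact: cvg_cst.
have [d0 Dd0 _] := Ddense _ z0 1 ltr01.
(* [d0] is the default at indices that number no element of [D]. *)
have choose n : exists g, D g /\ ((exists2 d, D d & i d = n) -> i g = n).
  have [[d Dd dn]|no] := pselect (exists2 d, D d & i d = n).
    by exists d.
  by exists d0.
have [g gP] := choice choose.
exists g; split=> [n|f df e e0]; first exact: DS (gP n).1.
have [d Dd dfd] := Ddense f df e e0; exists (i d) => v Sv.
have -> : g (i d) = d.
  apply: iinj; rewrite ?inE //; first exact: (gP _).1.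
  by apply: (gP _).2; exists d.
have [C1 _ fC] := dual_on_bounded sS df.
have [C2 _ dC] := dual_on_bounded sS (DS _ Dd).
have fdl : linear_on S (f - d).
  by move=> a u w Su Sw; rewrite !fctE (proj1 df) // (proj1 (DS _ Dd)) //; ring.
have fdC w : S w -> `|(f - d) w| <= (C1 + C2) * `|w|.
  move=> Sw; rewrite mulrDl; apply: le_trans (ler_normB _ _) _.
  by apply: lerD; [exact: fC | exact: dC].
have := le_dual_norm_on sS fdl fdC Sv; move=> /le_trans; apply.
by rewrite ler_wpM2r // ltW.
Qed.

(** A functional on the product is the sum of its restrictions to the two factors, each approximated
    within e / 2. *)
Lemma dual_approx_prod (X Y : normedModType R) (SX : set X) (SY : set Y) :
  subspace SX -> subspace SY -> separable_dual_on SX -> separable_dual_on SY ->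
  exists G c, dual_approx_on [set z : X * Y | SX z.1 /\ SY z.2] G c.
Proof.
move=> sX sY /(separable_dual_sequence sX)[g [gd gdense]].
move=> /(separable_dual_sequence sY)[h [hd hdense]].
pose pr n : nat * nat := odflt (0, 0)%N (unpickle n).
pose G n (z : X * Y) : R := g (pr n).1 z.1 + h (pr n).2 z.2.
pose S := [set z : X * Y | SX z.1 /\ SY z.2].
have bnd n : exists c : R, 0 <= c /\ forall v, S v -> `|G n v| <= c * `|v|.
  have [a a0 ga] := dual_on_bounded sX (gd (pr n).1).
  have [b b0 hb] := dual_on_bounded sY (hd (pr n).2).
  exists (a + b); split; first exact: addr_ge0.
  move=> v [Sv1 Sv2]; apply: le_trans (ler_normD _ _) _; rewrite mulrDl.
  apply: lerD.
    by apply: le_trans (ga _ Sv1) _; rewrite ler_wpM2l // prod_normE le_max lexx.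
  by apply: le_trans (hb _ Sv2) _; rewrite ler_wpM2l // prod_normE le_max lexx orbT.
have [c cP] := choice bnd.
exists G, c; split=> [n|f M e fl fM e0].
  split; [|exact: (cP n).1|exact: (cP n).2].
  move=> a u v [u1 u2] [v1 v2]; rewrite /G /= (proj1 (gd _)) // (proj1 (hd _)) //.
  by ring.
have e2 : 0 < e / 2 by lra.
have fdual (V : normedModType R) (SV : set V) (k : V -> R^o) :
    linear_on setT k -> (forall v, `|k v| <= M * `|v|) -> dual_on SV k.
  move=> kl kM; have [_ kc] := dual_of_bounded kl kM.
  split=> [a u v _ _|]; first exact: kl.
  exact: continuous_subspaceT.
have [|i Hi] := gdense (fun u => f (u, 0)) _ _ e2.
  apply: fdual => [a u v _ _|v].
    by rewrite -fl //; congr f; congr (_, _); rewrite /= scaler0 addr0.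
  by apply: le_trans (fM _) _; rewrite prod_normE /= normr0 (max_idPl _).
have [|j Hj] := hdense (fun u => f (0, u)) _ _ e2.
  apply: fdual => [a u v _ _|v].
    by rewrite -fl //; congr f; congr (_, _); rewrite /= scaler0 addr0.
  by apply: le_trans (fM _) _; rewrite prod_normE /= normr0 (max_idPr _).
exists (pickle (i, j)) => v [v1 v2].
have -> : f v - G (pickle (i, j)) v =
    (f (v.1, 0) - g i v.1) + (f (0, v.2) - h j v.2).
  rewrite /G /pr pickleK /=.
  have -> : f v = f (v.1, 0) + f (0, v.2).
    rewrite -(linear_onD fl) //; congr f; case: v {v1 v2} => v1 v2.
    by congr (_, _); rewrite /= ?addr0 ?add0r.
  by ring.
apply: le_trans (ler_normD _ _) _.
have -> : e * `|v| = e / 2 * `|v| + e / 2 * `|v| by field.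
apply: lerD.
  apply: le_trans (Hi _ v1) _; rewrite ler_wpM2l ?(ltW e2) //.
  by rewrite prod_normE le_max lexx.
apply: le_trans (Hj _ v2) _; rewrite ler_wpM2l ?(ltW e2) //.
by rewrite prod_normE le_max lexx orbT.
Qed.

End SeparableDual.

Lemma countable_closure (T : Type) (I : countType) (op : I -> T -> T -> T) (e : T) :
  exists A : set T, [/\ countable A, A e &
    forall i x y, A x -> A y -> A (op i x y)].
Proof.
(* The index [None] keeps the points already obtained, which makes the stages increasing. *)
pose step (B : set T) := \bigcup_(j in [set: option I])
  if j is Some i then [set op i p.1 p.2 | p in B `*` B] else B.
pose A k := iter k step [set e].
have Amono k m : (k <= m)%N -> A k `<=` A m.
  move=> /subnK <-; elim: (m - k)%N => // n IH x /IH Ax.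
  by exists None.
exists (\bigcup_k A k); split.
- apply: bigcup_countable => // k _; elim: k => [|k IH] /=; first exact: countable1.
  apply: bigcup_countable => // -[i|] _ //.
  apply: sub_countable (card_image_le _ _) _; exact: countableX.
- by exists 0%N.
- move=> i x y [k _ Ax] [m _ Ay]; exists (maxn k m).+1 => //.
  exists (Some i) => //; exists (x, y) => //; split.
    exact: (Amono k _ (leq_maxl _ _)).
  exact: (Amono m _ (leq_maxr _ _)).
Qed.

Lemma closure_near (R : realType) (Z : normedModType R) (A : set Z) z (r : R) :
  closure A z -> 0 < r -> exists2 w, A w & `|z - w| < r.
Proof.
move=> Az r0; have [w [Aw zw]] := Az _ (nbhsx_ballx z _ r0).
by exists w => //; move: zw; rewrite -ball_normE.
Qed.

Lemma near_closure (R : realType) (Z : normedModType R) (A : set Z) z :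
  (forall r : R, 0 < r -> exists2 w, A w & `|z - w| < r) -> closure A z.
Proof.
move=> H B /nbhs_ballP[r /= r0 rB]; have [w Aw zw] := H r r0.
by exists w; split=> //; apply: rB; rewrite -ball_normE.
Qed.

(** * Capturing violations inside a countably generated subspace *)

Section Reduction.
Context {R : realType} {X Y : normedModType R}.
Local Notation Z := (X * Y)%type.
Context (Om : set Z) (ybar : Y) (gamma a tau : R).

(* A term ((t, m), w) of a combination stands for t (w - z), where w - z is
   allowed an error 2^-m |w - z|. *)
Implicit Types (s : seq (R * nat * Z)) (z : Z) (t : R).

Definition comb_vec z s : Z := \sum_(x <- s) x.1.1 *: (x.2 - z).
Definition comb_err z s : R := \sum_(x <- s) x.1.1 * (2 ^- x.1.2 * `|x.2 - z|).
Definition comb_weight s : R := \sum_(x <- s) x.1.1.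

(* By exists_dual_triple, a normal with the required properties exists at z if
   and only if comb_gap z s t >= 0 for all admissible s and t. *)
Definition comb_gap z s t : R :=
  comb_err z s + a * max_norm gamma (comb_vec z s)
  + `|(comb_vec z s).2 + t *: (z.2 - ybar)| - t * (tau * `|z.2 - ybar|).

Hypotheses (gamma0 : 0 < gamma) (a0 : 0 <= a) (tau0 : 0 <= tau) (tau1 : tau <= 1).

(** Changing the base point moves the combined vector by the total weight times z' - z. Hence a
    strict violation persists at nearby base points, uniformly for bounded weights. *)
Lemma comb_gap_lipschitz z z' s t :
  (forall x, x \in s -> 0 <= x.1.1) -> 0 <= t ->
  comb_gap z s t <= comb_gap z' s t +
    (3 + a * Num.max 1 gamma) * (comb_weight s + t) * `|z - z'|.
Proof.
move=> s0 t0; set d := `|z - z'|; set W := comb_weight s.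
have ha := a0; have ht0 := tau0; have ht1 := tau1.
have d0 : 0 <= d by exact: normr_ge0.
have W0 : 0 <= W by rewrite /W /comb_weight big_seq sumr_ge0.
have d2 : `|z.2 - z'.2| <= d by rewrite /d prod_normE le_max lexx orbT.
have E : comb_vec z s - comb_vec z' s = W *: (z' - z).
  rewrite /comb_vec -sumrB scaler_suml; apply: eq_bigr => x _.
  by rewrite -scalerBr opprB addrC addrA subrK.
have nE : `|comb_vec z s - comb_vec z' s| = W * d.
  by rewrite E normrZ ger0_norm // distrC.
have H1 : comb_err z s <= comb_err z' s + W * d.
  rewrite /comb_err /W /comb_weight mulr_suml -big_split /= big_seq [leRHS]big_seq.
  apply: ler_sum => x xs; have x0 := s0 x xs.
  rewrite -mulrDr ler_wpM2l //.
  have p0 : 0 < (2 : R) ^- x.1.2 by rewrite invr_gt0 exprn_gt0.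
  have p1 : 2 ^- x.1.2 <= 1 :> R by rewrite invf_le1 ?exprn_gt0 // exprn_ege1 //; lra.
  have := ler_distD z' x.2 z; rewrite (distrC z' z) -/d => /(ler_wpM2l (ltW p0)).
  by have := ler_wpM2r d0 p1; lra.
have H2 : a * max_norm gamma (comb_vec z s) <=
    a * max_norm gamma (comb_vec z' s) + a * Num.max 1 gamma * (W * d).
  have := max_norm_lipschitz gamma0 (comb_vec z s) (comb_vec z' s).
  by rewrite nE => /(ler_wpM2l a0); lra.
have H3 : `|(comb_vec z s).2 + t *: (z.2 - ybar)| <=
    `|(comb_vec z' s).2 + t *: (z'.2 - ybar)| + (W * d + t * d).
  have -> : (comb_vec z s).2 + t *: (z.2 - ybar) =
     ((comb_vec z' s).2 + t *: (z'.2 - ybar)) +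
     ((comb_vec z s - comb_vec z' s).2 + t *: (z.2 - z'.2)).
    rewrite addrACA /= subrKC -scalerDr; congr (_ + _ *: _).
    by rewrite [RHS]addrC addrA subrK.
  apply: le_trans (ler_normD _ _) _; rewrite lerD2l.
  apply: le_trans (ler_normD _ _) _; apply: lerD.
    by rewrite -nE [leRHS]prod_normE le_max lexx orbT.
  by rewrite normrZ ger0_norm // ler_wpM2l.
have H4 : t * (tau * `|z'.2 - ybar|) <= t * (tau * `|z.2 - ybar|) + t * d.
  rewrite -mulrDr ler_wpM2l //.
  have := ler_distD z.2 z'.2 ybar; rewrite (distrC z'.2 z.2) => /(ler_wpM2l tau0).
  by have := ler_wpM2l tau0 d2; have := ler_wpM2r d0 tau1; lra.
have Wd : 0 <= W * d by exact: mulr_ge0.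
have td : 0 <= t * d by exact: mulr_ge0.
have K0 : 0 <= a * Num.max 1 gamma * (t * d).
  by rewrite !mulr_ge0 // le_max ler01.
by rewrite /comb_gap; move: H1 H2 H3 H4; lra.
Qed.

(** [A] is closed under the choice of a violating combination for each of its points and each of
    countably many quantitative requirements. A violation at a point of the closure is moved to a
    nearby point of [A], replaced by the chosen one, and moved back. *)
Theorem separable_reduction (z0 : Z) :
  exists A : set Z, [/\ countable A, A z0,
    forall (q : rat) x y, A x -> A y -> A (ratr q *: x + y),
    forall x, A x -> A (x.1, 0) /\ A (0, x.2) &
    forall z (kap : nat -> nat) s t, closure A z ->
      (forall x, x \in s -> [/\ 0 <= x.1.1, Om x.2 &
         `|x.2 - z| < 2 ^- (kap x.1.2).+2]) ->
      0 <= t -> comb_gap z s t < 0 ->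
      exists s' t', [/\ forall x, x \in s' -> [/\ 0 <= x.1.1, Om x.2, A x.2 &
         `|x.2 - z| < 2 ^- kap x.1.2], 0 <= t' & comb_gap z s' t' < 0]].
Proof.
have ha := a0.
(* The countable data are a list [l] of radius exponents, one for each admissible error index, a
   bound [T] on the weights, and the size 2^-j of the violation. *)
pose viol (zd : Z * (seq nat * nat * nat)) (st : seq (R * nat * Z) * R) :=
  let: (z, (l, T, j)) := zd in
  [/\ forall x, x \in st.1 -> [/\ 0 <= x.1.1, (x.1.2 < size l)%N, Om x.2 &
        `|x.2 - z| < 2 ^- nth 0%N l x.1.2],
      0 <= st.2, comb_weight st.1 + st.2 <= T%:R & comb_gap z st.1 st.2 < - 2 ^- j].
have ch zd : exists st, (exists st', viol zd st') -> viol zd st.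
  have [[st Hst]|no] := pselect (exists st', viol zd st'); first by exists st.
  by exists ([::], 0).
have [wit witP] := choice ch.
(* The operations are rational combinations, the two coordinate projections, and the n-th point of
   the witness chosen at [x], with default [x] beyond its end. *)
pose op (i : rat + bool + (seq nat * nat * nat) * nat) (x y : Z) : Z :=
  match i with
  | inl (inl q) => ratr q *: x + y
  | inl (inr true) => (x.1, 0)
  | inl (inr false) => (0, x.2)
  | inr (d, n) => nth x (map snd (wit (x, d)).1) n
  end.
have [A [Ac Az0 Aop]] := countable_closure op z0.
exists A; split=> //.
- by move=> q x y Ax Ay; exact: (Aop (inl (inl q))).
- by move=> x Ax; split; [exact: (Aop (inl (inr true)) x x)|
                          exact: (Aop (inl (inr false)) x x)].
have Awit z d x : A z -> x \in (wit (z, d)).1 -> A x.2.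
  move=> Az xs; have /(nthP z)[n _ <-] := map_f snd xs.
  exact: (Aop (inr (d, n)) z z).
move=> z kap s t Az sP t0 gap.
pose M := (\max_(x <- s) x.1.2).+1.
pose l := mkseq (fun m => (kap m).+1) M.
have sM x : x \in s -> (x.1.2 < M)%N.
  move=> xs; rewrite ltnS.
  exact: (@leq_bigmax_seq _ s xpredT (fun y => y.1.2)).
have lE m : (m < M)%N -> nth 0%N l m = (kap m).+1 by move=> mM; rewrite nth_mkseq.
have szl : size l = M by rewrite size_mkseq.
pose T := Num.bound (comb_weight s + t).
have W0 : 0 <= comb_weight s.
  by rewrite /comb_weight big_seq sumr_ge0 // => x /sP[].
have HT : comb_weight s + t <= T%:R by rewrite ltW // archi_boundP // addr_ge0.
have Ngap : 0 < - comb_gap z s t by rewrite oppr_gt0.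
(* Each change of base point costs less than 2^-j: a gap below -3 / 2^j becomes less than -2^-j at
   [z'], and the chosen one stays negative at [z]. The radius exponents drop likewise from kap + 2
   to kap + 1 to kap. *)
have [j Hj] := geom_lt 3 Ngap.
have j0 : 0 < (2 : R) ^- j by rewrite invr_gt0 exprn_gt0.
pose C := (3 + a * Num.max 1 gamma) * T%:R.
have C0 : 0 <= C by rewrite mulr_ge0 // addr_ge0 // mulr_ge0 // le_max ler01.
pose n := \max_(m < M) (kap m).+2.
have n0 : 0 < (2 : R) ^- n by rewrite invr_gt0 exprn_gt0.
have nk m : (m < M)%N -> 2 ^- n <= 2 ^- (kap m).+2 :> R.
  move=> mM; rewrite lef_pV2 ?posrE ?exprn_gt0 // ler_eXn2l //; last by lra.
  exact: (@leq_bigmax _ (fun m : 'I_M => (kap m).+2) (Ordinal mM)).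
pose r := Num.min (2 ^- n) (2 ^- j / (C + 1)).
have C1 : 0 < C + 1 by lra.
have r0 : 0 < r by rewrite lt_min n0 divr_gt0.
have [z' Az' zz'] := closure_near Az r0.
have Cr : C * `|z - z'| < 2 ^- j.
  have : `|z - z'| < 2 ^- j / (C + 1).
    by apply: (lt_le_trans zz'); rewrite ge_min lexx orbT.
  by rewrite ltr_pdivlMr //; have := normr_ge0 (z - z'); lra.
have rn : `|z - z'| < 2 ^- n by apply: (lt_le_trans zz'); rewrite ge_min lexx.
have gapC s' t' w w' : (forall x, x \in s' -> 0 <= x.1.1) -> 0 <= t' ->
    comb_weight s' + t' <= T%:R ->
    comb_gap w s' t' <= comb_gap w' s' t' + C * `|w - w'|.
  move=> s'0 t'0 HT'; apply: le_trans (comb_gap_lipschitz w w' s'0 t'0) _.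
  rewrite lerD2l ler_wpM2r // ler_wpM2l // addr_ge0 // mulr_ge0 // le_max ler01 //.
have p2 k : 2 ^- k.+1 = 2 ^- k / 2 :> R.
  by rewrite exprS; field; rewrite expf_neq0.
have : viol (z', (l, T, j)) (wit (z', (l, T, j))).
  apply: witP; exists (s, t); split=> //.
    move=> x xs; have [x0 Ox xz] := sP x xs; have xM := sM x xs.
    split=> //; rewrite ?size_mkseq // nth_mkseq //.
    have := ler_distD z x.2 z'; have := nk _ xM; move: xz; rewrite !p2; lra.
  have s0 x : x \in s -> 0 <= x.1.1 by move=> /sP[].
  have := gapC s t z' z s0 t0 HT; rewrite distrC; move: Hj Cr.
  by rewrite [3 / _]mulrC; lra.
case E: (wit _) => [s' t'] [s'P t'0 HT' gap'].
exists s', t'; split=> //.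
- move=> x xs; have [x0 xl Ox xz] := s'P x xs; split=> //.
    by apply: (Awit z' (l, T, j)) => //; rewrite E.
  rewrite size_mkseq in xl; move: xz; rewrite nth_mkseq // => xz.
  have := ler_distD z' x.2 z; rewrite (distrC z' z); have := nk _ xl.
  move: xz; rewrite !p2 => *.
  have : 0 < (2 : R) ^- (kap x.1.2) by rewrite invr_gt0 exprn_gt0.
  by lra.
- have s'0 x : x \in s' -> 0 <= x.1.1 by move=> /s'P[].
  by have := gapC s' t' z z' s'0 t'0 HT'; move: gap' Cr; lra.
Qed.

End Reduction.

(** * Frechet normals near a constrained minimizer *)

Section Frechet.
Context {R : realType}.

Lemma frechet_normal_coneI (Z : normedModType R) (A : set Z) z (f : Z -> R^o) :
  dual Z f ->
  (forall e : R, 0 < e -> exists2 r : R, 0 < r &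
     forall w, A w -> `|w - z| < r -> f (w - z) <= e * `|w - z|) ->
  frechet_normal_cone A z f.
Proof.
move=> df H; split=> //; apply/lee_addgt0Pr => e e0; rewrite add0e.
have [r r0 Hr] := H e e0.
pose V := [set w | [/\ A w, w != z & `|w - z| < r]].
apply: (@le_trans _ _ (ereal_sup ((fun w => (f (w - z) / `|w - z|)%:E) @` V))).
  apply: ereal_inf_lbound; exists V => //.
  apply/nbhs_ballP; exists r => // w; rewrite -ball_normE /= distrC => wr wz Aw.
  by split.
apply: ge_ereal_sup => _ [w [Aw wz wr] <-]; rewrite lee_fin.
by rewrite ler_pdivrMr ?normr_gt0 ?subr_eq0 // Hr.
Qed.

Lemma subspace_closure (Z : normedModType R) (A : set Z) :
  A !=set0 -> (forall (q : rat) x y, A x -> A y -> A (ratr q *: x + y)) ->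
  subspace (closure A).
Proof.
move=> [x0 Ax0] AQ; split.
  have := AQ (-1) _ _ Ax0 Ax0; rewrite rmorphN1 scaleN1r addNr.
  exact: subset_closure.
move=> a u v Au Av; apply: near_closure => r r0.
have r3 : 0 < r / 3 by lra.
have u1 : 0 < `|u| + 1 by have := normr_ge0 u; lra.
have d0 : 0 < r / 3 / (`|u| + 1) by exact: divr_gt0.
have [q] := @rat_in_itvoo R (a - r / 3 / (`|u| + 1)) (a + r / 3 / (`|u| + 1)) ltac:(lra).
rewrite in_itv /= => /andP[q1 q2].
have qa : `|a - ratr q| * (`|u| + 1) < r / 3.
  by rewrite -ltr_pdivlMr // ltr_norml; apply/andP; split; lra.
have q10 : 0 < `|ratr q : R| + 1 by have := normr_ge0 (ratr q : R); lra.
have [u' Au' uu'] := closure_near Au (divr_gt0 r3 q10).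
have [v' Av' vv'] := closure_near Av r3.
exists (ratr q *: u' + v'); first exact: AQ.
have -> : a *: u + v - (ratr q *: u' + v') =
    (a - ratr q) *: u + ratr q *: (u - u') + (v - v').
  by rewrite opprD addrACA; congr (_ + _); rewrite scalerBl scalerBr addrA subrK.
move: uu'; rewrite ltr_pdivlMr // => uu'.
apply: le_lt_trans (ler_normD _ _) _.
have := ler_normD ((a - ratr q) *: u) (ratr q *: (u - u')); rewrite 2!normrZ.
have := normr_ge0 (a - ratr q); have := normr_ge0 (u - u'); move: qa uu' vv'.
by lra.
Qed.

Context {X Y : normedModType R}.
Local Notation Z := (X * Y)%type.

(** Stability under projections makes the closure of [A] the product of the closures of its two
    slices, so the Asplund property is applied in each factor separately. *)
Lemma asplund_dual_approx (A : set Z) :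
  asplund X -> asplund Y -> A !=set0 -> countable A ->
  (forall (q : rat) x y, A x -> A y -> A (ratr q *: x + y)) ->
  (forall x, A x -> A (x.1, 0) /\ A (0, x.2)) ->
  subspace (closure A) /\ exists G c, dual_approx_on (closure A) G c.
Proof.
move=> aX aY A0 Ac AQ Apr; split; first exact: subspace_closure.
pose AX := [set x | A (x, 0)]; pose AY := [set y | A (0, y)].
have sX : subspace (closure AX).
  apply: subspace_closure; first by case: A0 => x /Apr[]; exists x.1.
  move=> q x y Ax Ay; rewrite /AX /= -[0](addr0 0) -{1}(scaler0 _ (ratr q)).
  exact: AQ Ax Ay.
have sY : subspace (closure AY).
  apply: subspace_closure; first by case: A0 => x /Apr[]; exists x.2.
  move=> q x y Ax Ay; rewrite /AY /= -[0](addr0 0) -{1}(scaler0 _ (ratr q)).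
  exact: AQ Ax Ay.
have sub (V : normedModType R) (B : set V) :
    subspace B -> GRing.submod_closed [in B].
  move=> [B0 BZ]; split; first by rewrite inE.
  by move=> a u v; rewrite !inE => Bu Bv; exact: BZ.
have cX : countable AX.
  apply: sub_countable (sub_countable (card_image_le fst A) Ac).
  by apply: subset_card_le => x Ax; exists (x, 0).
have cY : countable AY.
  apply: sub_countable (sub_countable (card_image_le snd A) Ac).
  by apply: subset_card_le => x Ax; exists (0, x).
have dX : separable_dual_on (closure AX).
  apply: aX; first exact: sub.
  by exists AX; split=> //; exact: subset_closure.
have dY : separable_dual_on (closure AY).
  apply: aY; first exact: sub.
  by exists AY; split=> //; exact: subset_closure.
have := dual_approx_prod sX sY dX dY.
suff -> : [set z : Z | closure AX z.1 /\ closure AY z.2] = closure A by [].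
apply/seteqP; split=> z.
  move=> [zX zY]; apply: near_closure => r r0.
  have [x Ax xz] := closure_near zX r0; have [y Ay yz] := closure_near zY r0.
  exists (x, y); last by rewrite prod_normE gt_max /= xz.
  have := AQ 1 _ _ Ax Ay; rewrite rmorph1 scale1r.
  by rewrite (_ : (x, 0) + (0, y) = (x, y)) //; congr (_, _); rewrite /= ?addr0 ?add0r.
move=> zA; split; apply: near_closure => r r0; have [w Aw wz] := closure_near zA r0.
  exists w.1; first exact: (Apr w Aw).1.
  by apply: le_lt_trans wz; rewrite [leRHS]prod_normE le_max lexx.
exists w.2; first exact: (Apr w Aw).2.
by apply: le_lt_trans wz; rewrite [leRHS]prod_normE le_max lexx orbT.
Qed.

Context (gamma : R) (gamma0 : 0 < gamma).

Lemma convex_fun_max_norm (a : R) (z0 : Z) :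
  0 <= a -> convex_fun (fun w => a * max_norm gamma (w - z0)).
Proof.
move=> a0 s t x y s0 t0 st; have [ND NZ] := @max_norm_sublinear _ X Y _ gamma0.
have -> : s *: x + t *: y - z0 = s *: (x - z0) + t *: (y - z0).
  by rewrite !scalerBr addrACA -opprD -scalerDl st scale1r.
by have := ND (s *: (x - z0)) (t *: (y - z0)); rewrite !NZ // => /(ler_wpM2l a0); lra.
Qed.

Lemma lipschitz_fun_max_norm (a : R) (z0 : Z) :
  0 <= a -> lipschitz_fun (a * Num.max 1 gamma) (fun w => a * max_norm gamma (w - z0)).
Proof.
move=> a0 x y; rewrite -mulrBr -mulrA ler_wpM2l //.
have := max_norm_lipschitz gamma0 (x - z0) (y - z0).
by rewrite opprB addrA subrK.
Qed.

Lemma convex_fun_snd (ybar : Y) : convex_fun (fun w : Z => `|w.2 - ybar|).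
Proof.
move=> s t x y s0 t0 st; have := convex_fun_norm ybar ler01 x.2 y.2 s0 t0 st.
by rewrite !mul1r.
Qed.

Lemma lipschitz_fun_snd (ybar : Y) : lipschitz_fun 1 (fun w : Z => `|w.2 - ybar|).
Proof.
move=> x y; have := lipschitz_fun_norm ybar ler01 x.2 y.2; rewrite !mul1r.
by move=> /le_trans; apply; rewrite [leRHS]prod_normE le_max lexx orbT.
Qed.

(* The hypotheses say that f is an eta-subgradient at z of
   w |-> |w.2 - ybar| + a N (w - z) and that - f is normal up to the errors
   2^-m at the points of s. *)
Lemma comb_gap_ge0 (f : Z -> R) (z : Z) (ybar : Y) (a eta th : R)
    (s : seq (R * nat * Z)) (t : R) :
  linear_on setT f ->
  (forall h, f h <= `|z.2 - ybar + h.2| - `|z.2 - ybar| + eta + a * max_norm gamma h) ->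
  0 < eta -> eta <= (1 - th) * `|z.2 - ybar| -> 0 <= t ->
  (forall x, x \in s -> 0 <= x.1.1 /\
     - (2 ^- x.1.2 * `|x.2 - z|) <= f (x.2 - z)) ->
  0 <= comb_gap ybar gamma a th z s t.
Proof.
move=> fl fU eta0 etath t0 sP; have [ND NZ] := @max_norm_sublinear _ X Y _ gamma0.
set h := comb_vec z s; set v := z.2 - ybar.
have flow : - comb_err z s <= f h.
  rewrite /comb_err /h /comb_vec; elim: s sP {h} => [|x s IH] sP.
    by rewrite !big_nil (linear_on0 (@subspaceT _ Z) fl) oppr0.
  rewrite !big_cons fl // opprD; apply: lerD.
    by have [x0 Hx] := sP x (mem_head _ _); rewrite -mulrN ler_wpM2l.
  by apply: IH => y ys; apply: sP; rewrite in_cons ys orbT.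
have pos u : 0 < u ->
    f h <= `|h.2 + u *: v| - u * `|v| + u * eta + a * max_norm gamma h.
  move=> u0; have ui : 0 < u^-1 by rewrite invr_gt0.
  have := fU (u^-1 *: h); rewrite (linear_onZ _ (@subspaceT _ Z) fl) // NZ //.
  rewrite -/v => /(ler_wpM2l (ltW u0)).
  have -> : u * (u^-1 * f h) = f h by rewrite mulrA divff ?gt_eqF // mul1r.
  have -> : `|h.2 + u *: v| = u * `|v + (u^-1 *: h).2|.
    have -> : h.2 + u *: v = u *: (v + u^-1 *: h.2).
      by rewrite [RHS]scalerDr scalerA divff ?gt_eqF // scale1r addrC.
    by rewrite normrZ gtr0_norm.
  have E : u * (u^-1 * (a * max_norm gamma h)) = a * max_norm gamma h.
    by rewrite mulrA divff ?gt_eqF // mul1r.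
  have -> : forall p q : R, u * (p - `|v| + eta + a * (u^-1 * q)) =
    u * p - u * `|v| + u * eta + u * (u^-1 * (a * q)) by move=> p q; ring.
  by rewrite E.
have [t00|t0'] := eqVneq t 0; last first.
  have tp : 0 < t by rewrite lt_def t0'.
  move: etath => /(ler_wpM2l t0); rewrite -/v.
  by have := pos t tp; rewrite /comb_gap -/h -/v; move: flow; lra.
(* For t = 0 no multiple of |v| absorbs [eta]; instead [pos] is used at u = e / eta, where the error
   u * eta equals the arbitrary [e]. *)
suff : f h <= `|h.2| + a * max_norm gamma h.
  by rewrite /comb_gap -/h -/v t00 scale0r addr0 mul0r subr0; move: flow; lra.
apply/ler_addgt0Pr => e e0; have u0 := divr_gt0 e0 eta0.
have := pos _ u0; rewrite mulfVK ?gt_eqF //.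
have := ler_normD h.2 ((e / eta) *: v); rewrite normrZ gtr0_norm //.
by lra.
Qed.

Theorem frechet_normal_near_minimizer (A : set Z) (z0 : Z) (ybar : Y)
    (a al tau r : R) :
  geom_complete Z -> asplund X -> asplund Y -> closed A -> A z0 ->
  z0.2 != ybar -> 0 <= a -> a < al -> 0 < tau -> tau < 1 -> 0 < r ->
  (forall w, A w ->
     `|z0.2 - ybar| <= `|w.2 - ybar| + a * max_norm gamma (w - z0)) ->
  exists (z : Z) (ys : Y -> R^o),
    [/\ A z, `|z - z0| <= r, dual Y ys /\ dual_norm ys = 1,
        tau * `|z.2 - ybar| < ys (z.2 - ybar) &
        (dist_gamma gamma (0, - ys)%R (frechet_normal_cone A z) < al%:E)%E].
Proof.
move=> cZ aX aY clA Az0 zy a0 aal tau0 tau1 r0 zmin.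
have hg := gamma0; have al0 : 0 < al by lra.
(* The margin a2 - a pays for the slope of the smooth perturbation. The threshold [th] exceeds both
   [tau] and a2 / al, so that the normalized distance a2 / th stays below [al]. *)
pose a2 := (a + al) / 2; have a2al : a2 < al by rewrite /a2; lra.
have a2a : a < a2 by rewrite /a2; lra.
pose th := (1 + Num.max tau (a2 / al)) / 2.
have a2al1 : a2 / al < 1 by rewrite ltr_pdivrMr // mul1r.
have m1 : Num.max tau (a2 / al) < 1 by rewrite gt_max tau1.
have th1 : th < 1 by rewrite /th; lra.
have mth : Num.max tau (a2 / al) < th by rewrite /th; lra.
have tauth : tau < th by apply: le_lt_trans mth; rewrite le_max lexx.
have th0 : 0 < th by lra.
have a2th : a2 / th < al.
  rewrite ltr_pdivrMr // mulrC -ltr_pdivrMr //.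
  by apply: le_lt_trans mth; rewrite le_max lexx orbT.
set v := z0.2 - ybar in zmin; have v0 : 0 < `|v| by rewrite normr_gt0 subr_eq0.
pose r' := Num.min r (`|v| / 2).
have r'0 : 0 < r' by rewrite lt_min r0 divr_gt0.
have g10 : 0 < Num.min 1 gamma by rewrite lt_min ltr01.
pose eps := (a2 - a) * Num.min 1 gamma.
have eps0 : 0 < eps by rewrite mulr_gt0 // subr_gt0.
(* The first entry makes [z0] nearly minimal for the smoothed function. The second, with |z.2 -
   ybar| >= |v| / 2 from the choice of [r'], provides the bound on [eta] in [comb_gap_ge0]. *)
pose eta := Num.min (eps * r' / 64) ((1 - th) * (`|v| / 2)).
have eta0 : 0 < eta.
  by rewrite lt_min !mulr_gt0 //= ?subr_gt0 // invr_gt0.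
have [AA [AAc AAz0 AAQ AApr AAred]] :=
  separable_reduction A ybar gamma0 (ltW (le_lt_trans a0 a2a)) (ltW th0) (ltW th1) z0.
have AA0 : AA !=set0 by exists z0.
have [sS [G [c dG]]] := asplund_dual_approx aX aY AA0 AAc AAQ AApr.
set S := closure AA in sS dG.
pose phi w := `|w.2 - ybar| + a * max_norm gamma (w - z0).
have phic : convex_fun phi.
  by apply: convex_funD (convex_fun_snd ybar) (convex_fun_max_norm z0 a0).
have K0 : 0 <= a * Num.max 1 gamma by rewrite mulr_ge0 // le_max ler01.
have phiL : lipschitz_fun (1 + a * Num.max 1 gamma) phi.
  by apply: lipschitz_funD (lipschitz_fun_snd ybar) (lipschitz_fun_max_norm z0 a0).
have phi0 w : 0 <= phi w by rewrite addr_ge0 // mulr_ge0 // max_norm_ge0.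
have L0 : 0 <= 1 + a * Num.max 1 gamma by rewrite addr_ge0.
have [Phi [Phic PhiL PhiS Phiphi]] := convex_smoothing sS dG L0 phic phiL eta0.
have z0phi : phi z0 = `|v|.
  by rewrite /phi subrr (sublinear0 (max_norm_sublinear gamma0)) mulr0 addr0.
have ASz0 : (A `&` S) z0 by split=> //; exact: subset_closure.
have [||psi [z [psic psiL psiS [[Az Sz] zz0 zm]]]] :=
  smooth_variational_principle cZ sS dG (closedI clA (@closed_closure _ AA))
  eps0 r'0 PhiL _ ASz0.
- exists (- eta) => w _; have /andP[+ _] := Phiphi w.
  by have := phi0 w; lra.
- move=> w [Aw _]; have /andP[_] := Phiphi z0; have /andP[+ _] := Phiphi w.
  have := zmin w Aw; rewrite z0phi /phi.
  have : eta <= eps * r' / 64 by rewrite ge_min lexx.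
  by lra.
set v1 := z.2 - ybar.
have v1v : `|v| / 2 <= `|v1|.
  have : `|z.2 - z0.2| <= `|v| / 2.
    apply: (@le_trans _ _ `|z - z0|); first by rewrite [leRHS]prod_normE le_max lexx orbT.
    by apply: (le_trans zz0); rewrite ge_min lexx orbT.
  by have := ler_distD z.2 z0.2 ybar; rewrite (distrC z0.2 z.2) -/v -/v1; lra.
have v10 : v1 != 0 by rewrite -normr_gt0; lra.
pose g := Phi \+ psi.
have gc : convex_fun g by exact: convex_funD.
have gL := lipschitz_funD PhiL psiL; rewrite -/g in gL.
have gS : smooth_along S g by exact: smooth_alongD.
have [f [fl _ fs]] := subgradient z (addr_ge0 L0 (ltW eps0)) gc gL.
have fU h : f h <= `|v1 + h.2| - `|v1| + eta + a2 * max_norm gamma h.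
  apply: (le_trans (fs h)); rewrite /g /=.
  have /andP[+ _] := Phiphi z; have /andP[_] := Phiphi (z + h).
  have := psiL (z + h) z; rewrite addrAC subrr add0r.
  have : eps * `|h| <= (a2 - a) * max_norm gamma h.
    by rewrite /eps -mulrA ler_wpM2l ?max_norm_lb // subr_ge0 ltW.
  have := (max_norm_sublinear gamma0).1 (z - z0) h => /(ler_wpM2l a0).
  rewrite /phi (addrAC z h (- z0)) /v1 /= (addrAC z.2 h.2); lra.
(* Smoothness at [z] bounds g (z - h) by 2 g z - g (z + h) + 2^-m |h|. Minimality over [A] in [S]
   and the subgradient inequality at - h then give the claim. *)
have kapE m : exists k : nat, forall w, A w -> S w ->
    `|w - z| < 2 ^- k -> - (2 ^- m * `|w - z|) <= f (w - z).
  have m0 : 0 < (2 : R) ^- m by rewrite invr_gt0 exprn_gt0.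
  have [d d0 Hd] := gS z _ m0; have [k] := geom_lt 1 d0; rewrite mul1r => Hk.
  exists k => w Aw Sw wz.
  have Swz : S (w - z) := subspaceD sS Sw (subspaceN sS Sz).
  have := Hd _ Swz (lt_trans wz Hk); have := fs (- (w - z)).
  rewrite (linear_onN (@subspaceT _ Z) fl) //.
  have := zm w (conj Aw Sw); rewrite subrKC /g /=; lra.
have [kap kapP] := choice kapE.
have nonneg s t : (forall x, x \in s -> [/\ 0 <= x.1.1, A x.2 &
    `|x.2 - z| < 2 ^- (kap x.1.2).+2]) -> 0 <= t ->
    0 <= comb_gap ybar gamma a2 th z s t.
  move=> sP t0; rewrite leNgt; apply/negP => gap.
  have [s' [t' [s'P t'0]]] := AAred z kap s t Sz sP t0 gap.
  apply/negP; rewrite -leNgt; apply: (@comb_gap_ge0 f z ybar a2 eta) => //.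
    apply: (@le_trans _ _ ((1 - th) * (`|v| / 2))); first by rewrite ge_min lexx orbT.
    by rewrite ler_wpM2l // subr_ge0 ltW.
  move=> x /s'P[x0 Ax AAx xz]; split=> //.
  by apply: kapP xz => //; exact: subset_closure.
(* Combinations make this a convex cone; single terms of weight 1 later give the Frechet inequality
   with error 2^-m on a ball depending on [m]. *)
pose K := [set h : Z * R | exists s, (forall x, x \in s -> [/\ 0 <= x.1.1, A x.2 &
    `|x.2 - z| < 2 ^- (kap x.1.2).+2]) /\ h = (comb_vec z s, comb_err z s)].
have a20 : 0 <= a2 by lra.
have [|_ t [s [sP ->]] t0|xs [b [ys [[xl bl yl] xb y1 yv KC]]]] :=
    exists_dual_triple (v0 := v1) (th := th * `|v1|) gamma0 a20 (K := K).
- split.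
  + by exists [::]; split=> //; rewrite /comb_vec /comb_err !big_nil.
  + move=> _ _ [s [sP ->]] [s' [s'P ->]]; exists (s ++ s'); split.
      by move=> x; rewrite mem_cat => /orP[/sP|/s'P].
    by rewrite /comb_vec /comb_err !big_cat.
  + move=> k _ k0 [s [sP ->]].
    exists [seq ((k * x.1.1, x.1.2), x.2) | x <- s]; split.
      by move=> _ /mapP[x /sP[x0 Ax xz] ->]; split=> //; exact: mulr_ge0 (ltW k0) x0.
    rewrite /comb_vec /comb_err !big_map scaler_sumr mulr_sumr.
    by congr (_, _); apply: eq_bigr => x _ /=; rewrite ?scalerA ?mulrA.
- by have := nonneg s t sP t0; rewrite /comb_gap /= -/v1; lra.
have [|us [du u1 _ uv dle]] := dist_gamma_normalized
    (N := frechet_normal_cone A z) gamma0 a20 th0 v10 xl bl yl xb y1 yv.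
  move=> s n s0 dn; apply: frechet_normal_coneI => // e e0.
  have [m Hm] := geom_lt s e0.
  exists (2 ^- (kap m).+2) => [|w Aw wz]; first by rewrite invr_gt0 exprn_gt0.
  rewrite /n /pairing /= -mulrDr.
  have : K (w - z, 2 ^- m * `|w - z|).
    exists [:: ((1, m), w)]; split.
      by move=> x; rewrite mem_seq1 => /eqP ->.
    by rewrite /comb_vec /comb_err !big_seq1 /= scale1r mul1r.
  move=> /KC /= /(ler_wpM2l (ltW s0)) /le_trans; apply.
  by rewrite mulrA ler_wpM2r // ltW.
exists z, us; split=> //.
- by apply: (le_trans zz0); rewrite ge_min lexx.
- by apply: lt_le_trans uv; rewrite ltr_pM2r // normr_gt0.
- by apply: (le_lt_trans dle); rewrite lte_fin.
Qed.

End Frechet.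

(** * Subregularity *)

Lemma ereal_between (R : realType) (al d : R) (M : \bar R) :
  0 < al -> (d%:E < al%:E * M)%E -> exists2 rho : R, d < al * rho & (rho%:E < M)%E.
Proof.
move=> al0; case: M => [m| |].
- rewrite -EFinM lte_fin => H; exists ((d / al + m) / 2).
    have : d = al * (d / al) by rewrite mulrCA divff ?gt_eqF // mulr1.
    by move: H; lra.
  rewrite lte_fin; have : d / al < m by rewrite ltr_pdivrMr // mulrC.
  by lra.
- move=> _; exists (d / al + 1); last exact: ltry.
  by rewrite mulrDr mulrCA divff ?gt_eqF // mulr1; lra.
- by rewrite gt0_muleNy ?lte_fin.
Qed.

Theorem theorem4p4 (R : realType) (P : Type) (X Y : completeNormedModType R)
    (F : P -> X -> set Y) (xbar : X) (ybar : Y) (alpha : R)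
    (delta mu : \bar R)
    (hP : inhabited P)
    (hF : forall p, closed (gph F p))
    (halpha : 0 < alpha)
    (hdelta : (0 < delta)%E)
    (hmu : (0 < mu)%E)
    (hcond : exists2 gamma : R, 0 < gamma &
      forall p : P,
        (forall (x : X) (y : Y),
           test_point F xbar ybar alpha delta mu p x y ->
           forall ys : Y -> R^o, dual Y ys -> dual_norm ys = 1 ->
             ys (y - ybar) = `|y - ybar| ->
             (alpha%:E <= dist_gamma gamma (0, - ys)%R
                            (clarke_normal_cone (gph F p) (x, y)))%E)
        \/
        [/\ asplund X, asplund Y &
            exists tau : R, 0 < tau < 1 /\
              forall (x : X) (y : Y),
                test_point F xbar ybar alpha delta mu p x y ->
                forall ys : Y -> R^o, dual Y ys -> dual_norm ys = 1 ->
                  tau * `|y - ybar| < ys (y - ybar) ->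
                  (alpha%:E <= dist_gamma gamma (0, - ys)%R
                                 (frechet_normal_cone (gph F p) (x, y)))%E]) :
  uniformly_subregular F xbar ybar alpha delta mu.
Proof.
move: hcond => [gamma g0 Hcond] p x xdelta dmu; rewrite leNgt; apply/negP => dlt.
have dfin : edist_inf (F p x) ybar \is a fin_num.
  rewrite ge0_fin_numE ?edist_inf_ge0 //; apply: lt_le_trans dmu _; exact: leey.
have [d dE] : exists d : R, edist_inf (F p x) ybar = d%:E.
  by exists (fine (edist_inf (F p x) ybar)); rewrite fineK.
have d0 : 0 <= d by rewrite -lee_fin -dE edist_inf_ge0.
rewrite dE in dmu dlt.
have [rho1 d1 rho1mu] := ereal_between halpha dmu.
have [rho2 d2 rho2inv] := ereal_between halpha dlt.
(* [rho] lies strictly below both [mu] and the distance from [x] to the solution set, while alpha *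
   rho exceeds the distance [d] from [ybar] to the image of [x]. *)
pose rho := Num.min rho1 rho2.
have drho : d < alpha * rho by rewrite /rho; case: (leP rho1 rho2).
have rhomu : (rho%:E < mu)%E.
  by apply: le_lt_trans rho1mu; rewrite lee_fin ge_min lexx.
have rhoinv : (rho%:E < edist_inf (Finv F p ybar) x)%E.
  by apply: le_lt_trans rho2inv; rewrite lee_fin ge_min lexx orbT.
have rho0 : 0 < rho by rewrite -(pmulr_rgt0 _ halpha); lra.
have [y0 Fy0 y0rho] : exists2 y0, F p x y0 & `|y0 - ybar| < alpha * rho.
  have : (edist_inf (F p x) ybar < (alpha * rho)%:E)%E by rewrite dE lte_fin.
  move=> /ereal_inf_lt[_ [y0 Fy0 <-] /edist_lt_ball]; rewrite -ball_normE /= => H.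
  by exists y0; rewrite // distrC.
have test (z : X * Y) : gph F p z -> `|z.1 - x| < rho ->
    `|z.2 - ybar| < alpha * rho -> test_point F xbar ybar alpha delta mu p z.1 z.2.
  move=> Fz zx zy; split=> //.
  - rewrite /eball /= addeC; apply: (@le_lt_trans _ _ (rho%:E + `|x - xbar|%:E)%E).
      rewrite -EFinD lee_fin; apply: le_trans (ler_distD x _ _) _.
      by rewrite lerD2r ltW.
    exact: lteD.
  - move=> Fzy; have : (edist_inf (Finv F p ybar) x <= rho%:E)%E.
      apply: (@le_trans _ _ (edist (x, z.1))).
        by apply: ereal_inf_lbound; exists z.1.
      by apply: edist_fin => //; rewrite -ball_normE /= distrC.
    by rewrite leNgt rhoinv.
  - rewrite /eball /=; apply: (@lt_trans _ _ (alpha * rho)%:E); first by rewrite lte_fin.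
    by rewrite EFinM lte_pmul2l.
(* Being above |y0 - ybar| / rho, [a] keeps Ekeland's point within [rho] of [x]; being below
   [alpha], it leaves room for the contradiction. *)
pose a := (`|y0 - ybar| / rho + alpha) / 2.
have ya : `|y0 - ybar| / rho < alpha by rewrite ltr_pdivrMr.
have y0a0 : 0 <= `|y0 - ybar| / rho by rewrite divr_ge0 // ltW.
have a0 : 0 < a by rewrite /a; lra.
have aal : a < alpha by rewrite /a; lra.
have y0a : `|y0 - ybar| / a < rho.
  by rewrite ltr_pdivrMr // mulrC -ltr_pdivrMr // /a; lra.
have cZ : geom_complete (X * Y)%type.
  by apply: geom_complete_prod; exact: geom_completeP.
have g10 : 0 < Num.min 1 gamma by rewrite lt_min ltr01.
have [z [Fz zy0 zmin]] := ekeland (z0 := (x, y0)) cZ (hF p) Fy0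
  (max_norm_sublinear g0) g10 (max_norm_lb g0) (max_norm_lipschitz g0)
  (lipschitz_fun_snd ybar) (fun w _ => normr_ge0 (w.2 - ybar)) a0.
have z2 : `|z.2 - ybar| <= `|y0 - ybar|.
  by apply: le_trans zy0; rewrite lerDl mulr_ge0 ?max_norm_ge0 // ltW.
have z1 : `|z.1 - x| <= `|y0 - ybar| / a.
  rewrite ler_pdivlMr // mulrC; apply: le_trans zy0.
  apply: (@le_trans _ _ (a * max_norm gamma (z - (x, y0)))); last by rewrite lerDr.
  by rewrite ler_pM2l // /max_norm le_max lexx.
have ztest := test z Fz (le_lt_trans z1 y0a) (le_lt_trans z2 y0rho).
have zy : z.2 != ybar.
  apply/eqP => zy; case: ztest => _ nF _ _; apply: nF.
  by rewrite /Finv /= -zy.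
have zz : z = (z.1, z.2) by case: (z).
case: (Hcond p) => [Hi|[aX aY [tau [/andP[tau0 tau1] Hii]]]].
  have [ys [dy y1 yz dle]] := clarke_normal_of_minimizer g0 (ltW a0) Fz zy zmin.
  have := Hi _ _ ztest ys dy y1 yz; rewrite -zz => /le_trans/(_ dle).
  by rewrite lee_fin leNgt aal.
(* Half of the remaining room, so that every graph point within [r] of [z] is still a test point. *)
pose r := Num.min (rho - `|y0 - ybar| / a) (alpha * rho - `|y0 - ybar|) / 2.
have m0 : 0 < Num.min (rho - `|y0 - ybar| / a) (alpha * rho - `|y0 - ybar|).
  by rewrite lt_min !subr_gt0 y0a.
have r0 : 0 < r by rewrite divr_gt0.
have [w [ys [Fw wz [dy y1] yw dlt']]] := frechet_normal_near_minimizer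
  g0 cZ aX aY (hF p) Fz zy (ltW a0) aal tau0 tau1 r0 zmin.
have r1 : r < rho - `|y0 - ybar| / a.
  apply: (@lt_le_trans _ _ (r * 2)); first by lra.
  by rewrite /r mulfVK ?gt_eqF // ge_min lexx.
have r2 : r < alpha * rho - `|y0 - ybar|.
  apply: (@lt_le_trans _ _ (r * 2)); first by lra.
  by rewrite /r mulfVK ?gt_eqF // ge_min lexx orbT.
have wz1 : `|w.1 - z.1| <= r.
  by apply: le_trans wz; rewrite [leRHS]prod_normE le_max lexx.
have wz2 : `|w.2 - z.2| <= r.
  by apply: le_trans wz; rewrite [leRHS]prod_normE le_max lexx orbT.
have wtest : test_point F xbar ybar alpha delta mu p w.1 w.2.
  apply: test => //.
    by apply: le_lt_trans (ler_distD z.1 _ _) _; lra.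
  by apply: le_lt_trans (ler_distD z.2 _ _) _; lra.
have := Hii _ _ wtest ys dy y1 yw; have <- : w = (w.1, w.2) by case: (w).
by rewrite leNgt dlt'.
Qed.
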